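(* Let $\theta\in\mathbb{R}^{n_\theta}$ and $\bar\xi=(\bar x,\bar z,\bar\mu)\in\Xi(\theta)$, with $\bar\mu=(\bar\lambda,\bar\nu)$ and $\bar\phi=(\bar x,\bar\lambda,\bar\nu)$. Then, for all $\rho>0$ sufficiently small, the primal-dual solution map $\eta(\cdot)$ of $P_3(\cdot,\bar\xi,\rho)$ is continuously differentiable at $\theta$. Moreover, the derivative at $\theta$ of its component $x(\cdot)$ with respect to $\theta$ is given by the first $n_x$ rows of the unique matrix $V$ solving the linear system $$[A_\theta(\bar\phi)+B^\rho_\theta(\bar\xi)]\,V=b_\theta(\bar\phi)+d^\rho_\theta(\bar\xi),$$ where $$A_\theta(\bar\phi)=\begin{bmatrix}\nabla_x^2\bar{\mathcal L}_\theta(\bar\phi)&\nabla_x g_{\theta,\mathcal I}(\bar x)^\top&\nabla_x h_\theta(\bar x)^\top\\ \nabla_x g_{\theta,\mathcal I}(\bar x)&0&0\\ \nabla_x h_\theta(\bar x)&0&0\end{bmatrix},\qquad b_\theta(\bar\phi)=\begin{bmatrix}\nabla^2_{\theta x}\bar{\mathcal L}_\theta(\bar\phi)\\ \nabla_\theta g_{\theta,\mathcal I}(\bar x)\\ \nabla_\theta h_\theta(\bar x)\end{bmatrix},$$ $$B^\rho_\theta(\bar\xi)=\begin{bmatrix}H+\rho I&0&0\\0&-\rho I&0\\0&0&-\rho I\end{bmatrix},\qquad d^\rho_\theta(\bar\xi)=\begin{bmatrix}l\\0\\0\end{bmatrix},$$ $$H=\nabla_x g_{\theta,\bar{\mathcal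 I}}(\bar x)^\top\operatorname{diag}\!\left(\frac{\rho}{\bar z_i^2+\rho^2}\right)_{i\in\bar{\mathcal I}}\nabla_x g_{\theta,\bar{\mathcal I}}(\bar x),\qquad l=\nabla_x g_{\theta,\bar{\mathcal I}}(\bar x)^\top\operatorname{diag}\!\left(\frac{\rho}{\bar z_i^2+\rho^2}\right)_{i\in\bar{\mathcal I}}\nabla_\theta g_{\theta,\bar{\mathcal I}}(\bar x).$$
   Context: Original problem. For a parameter $\theta\in\mathbb{R}^{n_\theta}$, $P_1(\theta)$ is the problem of minimizing $f_\theta(x)$ over $x\in\mathbb{R}^{n_x}$ subject to $g_\theta(x)\le 0$ and $h_\theta(x)=0$, where $f_\theta:\mathbb{R}^{n_x}\to\mathbb{R}$, $g_\theta:\mathbb{R}^{n_x}\to\mathbb{R}^{n_{\rm in}}$, $h_\theta:\mathbb{R}^{n_x}\to\mathbb{R}^{n_{\rm eq}}$ are twice continuously differentiable for all $\theta$, and $\nabla_x f_\theta,\nabla_x g_\theta,\nabla_x h_\theta$ are continuously differentiable in $\theta$. Let $X(\theta)$ be the set of local minimizers of $P_1(\theta)$, and $$\bar{\mathcal L}_\theta(x,\lambda,\nu)=f_\theta(x)+\sum_{i=1}^{n_{\rm in}}\lambda_i g_{\theta,i}(x)+\sum_{j=1}^{n_{\rm eq}}\nu_j h_{\theta,j}(x).$$ $\Phi(\theta)$ is the set of all $\phi=(x,\lambda,\nu)$ with $x\in X(\theta)$ satisfying the KKT conditions $\nabla_x\bar{\mathcal L}_\theta(x,\lambda,\nu)=0$,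 $g_\theta(x)\le 0$, $h_\theta(x)=0$, $\lambda_i g_{\theta,i}(x)=0$ and $\lambda_i\ge 0$ for all $i$. Standing assumption: $\Phi(\theta)\neq\emptyset$ for all values of $\theta$ of interest. $\mathcal I=\mathcal I(\bar x)$ is the set of indices $i\in\{1,\dots,n_{\rm in}\}$ with $g_{\theta,i}(\bar x)=0$, $\bar{\mathcal I}=\bar{\mathcal I}(\bar x)$ is its complement, and $g_{\theta,\mathcal I}$, $g_{\theta,\bar{\mathcal I}}$ stack the corresponding components of $g_\theta$. $\nabla_x g$, $\nabla_\theta g$ etc. denote Jacobians of vector-valued functions (one row per component), and $\nabla^2_{\theta x}\bar{\mathcal L}_\theta$ is the $n_x\times n_\theta$ Jacobian with respect to $\theta$ of $\nabla_x\bar{\mathcal L}_\theta$. Slack form. Let $n_\mu=n_{\rm in}+n_{\rm eq}$ and, for $z\in\mathbb{R}^{n_{\rm in}}$, $c_\theta(x,z)=\begin{bmatrix}g_\theta(x)+z^2/2\\ h_\theta(x)\end{bmatrix}$ with the square taken componentwise. Define $$\Xi(\theta)=\{(x,z,\mu):\ \mu=(\lambda,\nu),\ (x,\lambda,\nu)\in\Phi(\theta),\ z_i=\sqrt{-2g_{\theta,i}(x)}\ \text{for all } i\}.$$ Regularized problem. For a fixed $\bar\xi=(\bar x,\bar z,\bar\mu)$, $\rho>0$ and parameter $\theta'$, $P_3(\theta',\bar\xi,\rho)$ is the problem in the variable $\xi=(x,z,\mu)$ $$\min_{\xi}\ f_{\theta'}(x)+\frac{\rho}{2}\left[\|x-\bar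 x\|^2+\|z-\bar z\|^2+\|\mu\|^2\right]\quad\text{subject to}\quad c_{\theta'}(x,z)+\rho(\bar\mu-\mu)=0,$$ with multiplier $\psi=(\psi_{\rm in},\psi_{\rm eq})\in\mathbb{R}^{n_\mu}$ for the equality constraint. A primal-dual solution is a pair $\eta=(\xi,\psi)$ whose primal part is a local minimizer and which satisfies the KKT conditions $$\nabla_x f_{\theta'}(x)+\rho(x-\bar x)+\sum_{i=1}^{n_\mu}\psi_i\nabla_x c_{\theta',i}(x,0)=0,\quad \operatorname{diag}(\psi_{\rm in})z+\rho(z-\bar z)=0,\quad \rho(\mu-\psi)=0,\quad c_{\theta'}(x,z)+\rho(\bar\mu-\mu)=0.$$ The primal-dual solution map is the local (single-valued) map $\theta'\mapsto\eta(\theta')=(x(\theta'),z(\theta'),\mu(\theta'),\psi(\theta'))$, defined for $\theta'$ in a neighborhood of $\theta$ with $\bar\xi$ held fixed, that sends $\theta'$ to a primal-dual solution of $P_3(\theta',\bar\xi,\rho)$ and satisfies $\eta(\theta)=(\bar x,\bar z,\bar\mu,\bar\mu)$.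
   Formalization: The derivative of x(·) is minus the first n_x rows of V (the stated sign is false); existence of η is asserted only if (ξ̄,μ̄) is a primal-dual solution of P_3 at θ, as η(θ) requires; ∇_x f, ∇_x g, ∇_x h, and also g, h, are assumed C^1 jointly in (θ,x). *)

(* Defs.v *)
From HB Require Import structures.
From mathcomp Require Export all_boot all_order all_algebra.
From mathcomp Require Export boolp classical_sets functions reals.
From mathcomp Require Export topology prodnormedzmodule normedtype landau derive.

Set Implicit Arguments.
Unset Strict Implicit.
Unset Printing Implicit Defensive.
Export Order.TTheory GRing.Theory Num.Theory.
Export numFieldNormedType.Exports.

Local Open Scope classical_set_scope.
Local Open Scope ring_scope.

(* Points of R^n are row vectors, as in the library's Jacobian 'J. *)

Section Calculus.
Context {R : realType}.

(* 'J F p acts on row vectors by right multiplication, so its rows are indexed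
   by the variables; Jac has one row per component of F. *)
Definition Jac (n m : nat) (F : 'rV[R]_n -> 'rV[R]_m) (p : 'rV[R]_n) :
  'M[R]_(m, n) := ('J F p)^T.

Definition grad (n : nat) (F : 'rV[R]_n -> R) (p : 'rV[R]_n) : 'rV[R]_n :=
  \row_j 'D_(delta_mx 0 j) F p.

(* V is always finite-dimensional below, so that continuity of the differential
   in operator norm amounts to continuity of its value at each vector v. *)
Definition C1_at (V W : normedModType R) (F : V -> W) (p : V) : Prop :=
  (\forall q \near p, differentiable F q) /\
  (forall v : V, {for p, continuous (fun q => 'd F q v)}).

(* The norms of the library on 'rV[R]_n are sup norms; this is the square of
   the Euclidean one. *)
Definition sqnorm (n : nat) (u : 'rV[R]_n) : R := \sum_j u 0 j ^+ 2.

Definition local_minimizer (T : topologicalType) (S : set T) (F : T -> R)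
    (x : T) : Prop :=
  S x /\ \forall y \near x, S y -> F x <= F y.

Definition subvec (n : nat) (A : {set 'I_n}) (v : 'rV[R]_n) : 'rV[R]_#|A| :=
  colsub enum_val v.

End Calculus.

Section Problem.
Context {R : realType} {nt nx nin neq : nat}.
Variables (f : 'rV[R]_nt -> 'rV[R]_nx -> R)
          (g : 'rV[R]_nt -> 'rV[R]_nx -> 'rV[R]_nin)
          (h : 'rV[R]_nt -> 'rV[R]_nx -> 'rV[R]_neq).

(* C^1 dependence of the gradients on the parameter is understood jointly in
   (theta, x), as needed by the implicit function theorem. The constraints
   themselves, whose parameter Jacobians occur in bvec and dvec, are also C^1
   in (theta, x). *)
Record smooth_data : Prop := SmoothData {
  f_C2 : forall t x, C1_at (f t) x /\ C1_at (grad (f t)) x ;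
  g_C2 : forall t x, C1_at (g t) x /\ C1_at (Jac (g t)) x ;
  h_C2 : forall t x, C1_at (h t) x /\ C1_at (Jac (h t)) x ;
  grad_f_C1 : forall p, C1_at (fun q : 'rV_nt * 'rV_nx => grad (f q.1) q.2) p ;
  Jac_g_C1 : forall p, C1_at (fun q : 'rV_nt * 'rV_nx => Jac (g q.1) q.2) p ;
  Jac_h_C1 : forall p, C1_at (fun q : 'rV_nt * 'rV_nx => Jac (h q.1) q.2) p ;
  g_C1 : forall p, C1_at (fun q : 'rV_nt * 'rV_nx => g q.1 q.2) p ;
  h_C1 : forall p, C1_at (fun q : 'rV_nt * 'rV_nx => h q.1 q.2) p }.

Definition feasible (t : 'rV[R]_nt) : set 'rV[R]_nx :=
  [set x | (forall i, g t x 0 i <= 0) /\ h t x = 0].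

Definition minimizers (t : 'rV[R]_nt) : set 'rV[R]_nx :=
  [set x | local_minimizer (feasible t) (f t) x].

Definition lagrangian (t : 'rV[R]_nt) (x : 'rV[R]_nx)
    (lam : 'rV[R]_nin) (nu : 'rV[R]_neq) : R :=
  f t x + \sum_i lam 0 i * g t x 0 i + \sum_j nu 0 j * h t x 0 j.

Definition Phi (t : 'rV[R]_nt) : set ('rV[R]_nx * 'rV[R]_nin * 'rV[R]_neq) :=
  [set phi : 'rV[R]_nx * 'rV[R]_nin * 'rV[R]_neq | let: (x, lam, nu) := phi in
    [/\ minimizers t x,
        grad (fun y => lagrangian t y lam nu) x = 0,
        (forall i, g t x 0 i <= 0) /\ h t x = 0,
        forall i, lam 0 i * g t x 0 i = 0
      & forall i, 0 <= lam 0 i] ].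

Definition Xi (t : 'rV[R]_nt) :
    set ('rV[R]_nx * 'rV[R]_nin * 'rV[R]_(nin + neq)) :=
  [set xi : 'rV[R]_nx * 'rV[R]_nin * 'rV[R]_(nin + neq) | let: (x, z, mu) := xi in
    Phi t (x, lsubmx mu, rsubmx mu) /\
    forall i, z 0 i = Num.sqrt (- (2 * g t x 0 i))].

Definition slack_con (t : 'rV[R]_nt) (x : 'rV[R]_nx) (z : 'rV[R]_nin) :
    'rV[R]_(nin + neq) :=
  row_mx (g t x + \row_i (z 0 i ^+ 2 / 2)) (h t x).

Section Regularized.
Variables (xib : 'rV[R]_nx * 'rV[R]_nin * 'rV[R]_(nin + neq)) (rho : R).
Let xb := xib.1.1.
Let zb := xib.1.2.
Let mub := xib.2.

Definition P3_obj (t : 'rV[R]_nt)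
    (xi : 'rV[R]_nx * 'rV[R]_nin * 'rV[R]_(nin + neq)) : R :=
  let: (x, z, mu) := xi in
  f t x + rho / 2 * (sqnorm (x - xb) + sqnorm (z - zb) + sqnorm mu).

Definition P3_feasible (t : 'rV[R]_nt) :
    set ('rV[R]_nx * 'rV[R]_nin * 'rV[R]_(nin + neq)) :=
  [set xi : 'rV[R]_nx * 'rV[R]_nin * 'rV[R]_(nin + neq) | let: (x, z, mu) := xi in
    slack_con t x z + rho *: (mub - mu) = 0].

(* A pair eta = (xi, psi). *)
Definition P3_primal_dual_solution (t : 'rV[R]_nt)
    (eta : 'rV[R]_nx * 'rV[R]_nin * 'rV[R]_(nin + neq) * 'rV[R]_(nin + neq)) :
    Prop :=
  let: (x, z, mu, psi) := eta in
  local_minimizer (P3_feasible t) (P3_obj t) (x, z, mu) /\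
  [/\ grad (f t) x + rho *: (x - xb)
        + \sum_i psi 0 i *: grad (fun y => slack_con t y 0 0 i) x = 0,
      z *m diag_mx (lsubmx psi) + rho *: (z - zb) = 0,
      rho *: (mu - psi) = 0
    & slack_con t x z + rho *: (mub - mu) = 0].

Definition base_pair :
    'rV[R]_nx * 'rV[R]_nin * 'rV[R]_(nin + neq) * 'rV[R]_(nin + neq) :=
  (xib, mub).

(* A single-valued localization, around theta for base_pair, of the
   set-valued map that sends t to the primal-dual solutions at t. No
   regularity of eta is assumed. Such an eta can only exist if base_pair is a
   primal-dual solution at theta; its KKT conditions hold there as soon as xib
   is in Xi theta, but its local minimality may fail for every rho. *)
Definition P3_solution_map (theta : 'rV[R]_nt)
    (eta : 'rV[R]_nt ->
      'rV[R]_nx * 'rV[R]_nin * 'rV[R]_(nin + neq) * 'rV[R]_(nin + neq)) :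
    Prop :=
  eta theta = base_pair /\
  exists2 U, nbhs base_pair U &
    \forall t \near theta,
      [/\ U (eta t), P3_primal_dual_solution t (eta t)
        & forall e, U e -> P3_primal_dual_solution t e -> e = eta t].

End Regularized.

Definition active (t : 'rV[R]_nt) (x : 'rV[R]_nx) : {set 'I_nin} :=
  [set i | g t x 0 i == 0]%SET.

Definition inactive (t : 'rV[R]_nt) (x : 'rV[R]_nx) : {set 'I_nin} :=
  (~: active t x)%SET.

Section System.
Variables (theta : 'rV[R]_nt)
          (xib : 'rV[R]_nx * 'rV[R]_nin * 'rV[R]_(nin + neq)) (rho : R).
Let x := xib.1.1.
Let z := xib.1.2.
Let lam : 'rV[R]_nin := lsubmx xib.2.
Let nu : 'rV[R]_neq := rsubmx xib.2.

Let I := active theta x.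
Let Ic := inactive theta x.

Definition Amat : 'M[R]_(nx + (#|I| + neq)) :=
  let GI := Jac (fun y => subvec I (g theta y)) x in
  let Hx := Jac (h theta) x in
  block_mx (Jac (grad (fun y => lagrangian theta y lam nu)) x)
           (row_mx GI^T Hx^T)
           (col_mx GI Hx)
           0.

Definition bvec : 'M[R]_(nx + (#|I| + neq), nt) :=
  col_mx (Jac (fun t => grad (fun y => lagrangian t y lam nu) x) theta)
    (col_mx (Jac (fun t => subvec I (g t x)) theta)
            (Jac (fun t => h t x) theta)).

Definition inactive_weight : 'M[R]_#|Ic| :=
  diag_mx (\row_k (rho / (z 0 (enum_val k) ^+ 2 + rho ^+ 2))).

Definition Hmat : 'M[R]_nx :=
  let GIc := Jac (fun y => subvec Ic (g theta y)) x in
  GIc^T *m inactive_weight *m GIc.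

Definition lmat : 'M[R]_(nx, nt) :=
  (Jac (fun y => subvec Ic (g theta y)) x)^T *m inactive_weight
    *m Jac (fun t => subvec Ic (g t x)) theta.

Definition Bmat : 'M[R]_(nx + (#|I| + neq)) :=
  block_mx (Hmat + rho%:M) 0 0
           (block_mx (- rho%:M) 0 0 (- rho%:M)).

Definition dvec : 'M[R]_(nx + (#|I| + neq), nt) :=
  col_mx lmat (col_mx 0 0).

(* The right-hand side is the parameter derivative of the (reduced) KKT
   residual, whereas A + B is its derivative in the unknowns: the derivative of
   the solution is therefore the opposite of the solution V. *)
Definition sensitivity_system (V : 'M[R]_(nx + (#|I| + neq), nt)) : Prop :=
  (Amat + Bmat) *m V = bvec + dvec.

End System.

End Problem.

Arguments sensitivity_system {R nt nx nin neq} f g h theta xib rho V.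

(* Main.v *)
Require Import Defs.
From HB Require Import structures.
From mathcomp Require Import lra ring.

(** The KKT conditions of the regularized problem are a nonsingular system of
    equations, the solution map is the implicit function that they define, and
    V comes from their linearization once the slack increments are eliminated.

    The equality constraint can be solved for mu, so the regularized problem is
    the unconstrained minimization in y = (x, z) of [reduced_obj], an augmented
    Lagrangian with gradient [residual] ([P3_min_reduced], [P3_kktE],
    [diff_reduced_obj]).  Eliminating the slack increments from the
    linearization of residual = 0 at the base point gives (A + B) w = - (b + d) dt,
    where w collects the increments of x, of the active multipliers and of the
    equality multipliers ([dresidual_system]).  Because the multipliers are
    nonnegative, the linearization in y is injective as soon as A + B is
    ([dresidual_injective]).

    The matrix A + B is a saddle-point matrix whose entries are rational in
    rho on the positive half-line.  For large rho its upper left block is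
    positive definite and it is invertible; its determinant is therefore a
    nonzero rational function, which has no zero near 0+ ([system_unitmx]).

    A branch of solutions is obtained by minimization rather than by a fixed
    point ([local_min_branch]).  The base point is a strict local minimizer: a
    point nearby with the same value would be a local minimizer too, hence a
    second zero of the residual.  The gap that this leaves on a small sphere
    survives small changes of the parameter, so that the minimum over the closed
    ball is attained inside.  The minimizer is a zero of the residual, and it has
    the local minimality required of a primal-dual solution.

    Regularity is handled with strict differentiability, a first-order expansion
    uniform over pairs of points.  It follows from C^1 in finite dimension
    ([C1_at_strict_diff]), is stable under the operations used here, and holding
    at all points of a neighbourhood it gives C^1 back ([strict_diff_C1_at]).
    Injectivity of the partial derivative then yields by one and the same
    estimate the local uniqueness of zeros, a Lipschitz bound, and the strict
    differentiability of the branch ([implicit_lipschitz],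
    [implicit_strict_diff]).  Finally, any localization of the solution map
    coincides with the branch near theta, since the branch enters the
    neighbourhood on which that localization is unique
    ([solution_map_sensitivity]). *)

Set Implicit Arguments.
Unset Strict Implicit.
Unset Printing Implicit Defensive.
Local Open Scope classical_set_scope.
Local Open Scope ring_scope.

(** * Strict differentiability *)

Definition bounded_linear (R : realType) (V W : normedModType R) (L : V -> W) :=
  linear L /\ exists C, forall v, `|L v| <= C * `|v|.

Section BoundedLinear.
Context {R : realType}.
Implicit Types V W : normedModType R.

Lemma bl_linear V W (L : V -> W) :
  bounded_linear L -> exists f : {linear V -> W}, L = f.
Proof.
move=> [linL _].
pose m := GRing.isLinear.Build _ _ _ _ _ linL.
pose f : {linear V -> W} := HB.pack L m.
by exists f.
Qed.

Lemma bl0 V W (L : V -> W) : bounded_linear L -> L 0 = 0.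
Proof. by case/bl_linear=> f ->; rewrite linear0. Qed.
Lemma blD V W (L : V -> W) u v : bounded_linear L -> L (u + v) = L u + L v.
Proof. by case/bl_linear=> f ->; rewrite linearD. Qed.
Lemma blB V W (L : V -> W) u v : bounded_linear L -> L (u - v) = L u - L v.
Proof. by case/bl_linear=> f ->; rewrite linearB. Qed.
Lemma blZ V W (L : V -> W) a u : bounded_linear L -> L (a *: u) = a *: L u.
Proof. by case/bl_linear=> f ->; rewrite linearZ. Qed.

Lemma bl_bound V W (L : V -> W) : bounded_linear L ->
  exists2 C, 0 < C & forall v, `|L v| <= C * `|v|.
Proof.
move=> [_ [C bC]]; exists (`|C| + 1) => [|v]; first by rewrite ltr_wpDl.
apply: le_trans (bC v) _; apply: ler_wpM2r => //.
by rewrite ler_wpDr// ler_norm.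
Qed.

Lemma bl_continuous V W (L : V -> W) : bounded_linear L -> continuous L.
Proof.
move=> bL; have [C C0 bC] := bl_bound bL.
move=> x; apply/cvgrPdist_lt => e e0.
apply/nbhs_normP; exists (e / C); first by rewrite /= divr_gt0.
move=> y /= xy; rewrite -blB//; apply: le_lt_trans (bC _) _.
by rewrite mulrC -ltr_pdivlMr.
Qed.

Lemma continuous_bl V W (f : {linear V -> W}) :
  continuous f -> bounded_linear f.
Proof.
move=> cf; split; first exact: linearP.
by have [k k0 bk] := linear_lipschitz cf; exists k.
Qed.

Lemma bl_cst0 V W : bounded_linear (fun _ : V => 0 : W).
Proof.
split; first by move=> a u v; rewrite scaler0 addr0.
by exists 0 => v; rewrite normr0 mul0r.
Qed.

Lemma bl_id V : bounded_linear (@id V).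
Proof. by split=> //; exists 1 => v; rewrite mul1r. Qed.

Lemma bl_add V W (L M : V -> W) : bounded_linear L -> bounded_linear M ->
  bounded_linear (fun v => L v + M v).
Proof.
move=> bL bM; split.
  move=> a u v.
  by rewrite !(blD _ _ bL, blD _ _ bM, blZ _ _ bL, blZ _ _ bM) scalerDr addrACA.
have [C _ hC] := bl_bound bL; have [D _ hD] := bl_bound bM.
exists (C + D) => v; rewrite mulrDl; apply: le_trans (ler_normD _ _) _.
by rewrite lerD.
Qed.

Lemma bl_comp V W (X : normedModType R) (L : W -> X) (M : V -> W) :
  bounded_linear L -> bounded_linear M -> bounded_linear (fun v => L (M v)).
Proof.
move=> bL bM; split.
  by move=> a u v; rewrite !(blD _ _ bM, blZ _ _ bM) (blD _ _ bL) (blZ _ _ bL).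
have [C C0 hC] := bl_bound bL; have [D _ hD] := bl_bound bM.
exists (C * D) => v; apply: le_trans (hC _) _.
by rewrite -mulrA ler_wpM2l// ltW.
Qed.

Lemma bl_scale V W a (L : V -> W) : bounded_linear L ->
  bounded_linear (fun v => a *: L v).
Proof.
move=> bL; split.
  by move=> b u v; rewrite (blD _ _ bL) (blZ _ _ bL) scalerDr !scalerA mulrC.
have [C C0 hC] := bl_bound bL; exists (`|a| * C) => v.
by rewrite normrZ -mulrA ler_wpM2l.
Qed.

Lemma bl_pair V W (X : normedModType R) (L : V -> W) (M : V -> X) :
  bounded_linear L -> bounded_linear M -> bounded_linear (fun v => (L v, M v)).
Proof.
move=> bL bM; split.
  by move=> a u v; rewrite (blD _ _ bL) (blZ _ _ bL) (blD _ _ bM) (blZ _ _ bM).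
have [C C0 hC] := bl_bound bL; have [D D0 hD] := bl_bound bM.
exists (C + D) => v; rewrite prod_normE ge_max /=; apply/andP; split.
  by apply: le_trans (hC _) _; rewrite ler_wpM2r// lerDl ltW.
by apply: le_trans (hD _) _; rewrite ler_wpM2r// lerDr ltW.
Qed.

Lemma bl_fst V W : bounded_linear (@fst V W).
Proof.
split=> //; exists 1 => v; rewrite mul1r prod_normE le_max lexx //.
Qed.

Lemma bl_snd V W : bounded_linear (@snd V W).
Proof.
split=> //; exists 1 => v; rewrite mul1r prod_normE le_max lexx orbT //.
Qed.

Lemma le_coord_norm m n (M : 'M[R]_(m, n)) i j : `|M i j| <= `|M|.
Proof.
rewrite [leRHS]/Num.Def.normr /= mx_normrE; apply/bigmax_geP; right => /=.
by exists (i, j).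
Qed.

Lemma mx_norm_le m n (M : 'M[R]_(m, n)) e : 0 <= e ->
  (forall i j, `|M i j| <= e) -> `|M| <= e.
Proof.
move=> e0 h; rewrite [leLHS]/Num.Def.normr /= mx_normrE.
by apply: bigmax_le => // -[i j] _ /=.
Qed.

(** Expanding v on the elementary matrices bounds L by its values on them. *)
Lemma linear_mx_norm_le m n W (L : 'M[R]_(m, n) -> W) v : linear L ->
  `|L v| <= (\sum_i \sum_j `|L (delta_mx i j)|) * `|v|.
Proof.
move=> linL; pose mi := GRing.isLinear.Build _ _ _ _ _ linL.
pose f : {linear 'M[R]_(m, n) -> W} := HB.pack L mi.
rewrite -[L]/(f : _ -> _) {1}(matrix_sum_delta v) linear_sum.
apply: le_trans (ler_norm_sum _ _ _) _; rewrite mulr_suml.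
apply: ler_sum => i _; rewrite linear_sum.
apply: le_trans (ler_norm_sum _ _ _) _; rewrite mulr_suml.
apply: ler_sum => j _; rewrite linearZ /= normrZ mulrC ler_wpM2l//.
exact: le_coord_norm.
Qed.

Lemma bl_mx m n W (L : 'M[R]_(m, n) -> W) : linear L -> bounded_linear L.
Proof.
by move=> linL; split=> //; eexists => v; apply: linear_mx_norm_le.
Qed.

Lemma norm_mulmx_le m n p (A : 'M[R]_(m, n)) (B : 'M[R]_(n, p)) :
  `|A *m B| <= n%:R * (`|A| * `|B|).
Proof.
apply: mx_norm_le => [|i j]; first by rewrite mulr_ge0// mulr_ge0.
rewrite mxE; apply: le_trans (ler_norm_sum _ _ _) _.
rewrite -[n in n%:R]card_ord -sumr_const mulr_suml ler_sum// => k _.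
by rewrite mul1r normrM ler_pM// le_coord_norm.
Qed.

End BoundedLinear.

(** The expansion is required for all pairs q, q' near p, and not only for
    pairs (q, p): this is what makes the inverse and implicit function
    estimates work at the single point p. *)
Record strict_diff (R : realType) (V W : normedModType R) (F : V -> W) (p : V)
    (L : V -> W) : Prop := StrictDiff {
  sd_bl : bounded_linear L;
  sd_approx : forall e : R, 0 < e -> exists2 d : R, 0 < d & forall q q',
    `|q - p| < d -> `|q' - p| < d ->
    `|F q - F q' - L (q - q')| <= e * `|q - q'| }.

Section StrictDiff.
Context {R : realType}.
Implicit Types V W : normedModType R.

Lemma strict_diff_lipschitz V W (F : V -> W) p L : strict_diff F p L ->
  exists C d, [/\ 0 < C, 0 < d & forall q q', `|q - p| < d -> `|q' - p| < d ->
    `|F q - F q'| <= C * `|q - q'|].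
Proof.
move=> [bL /(_ 1 ltr01)[d d0 h]]; have [C C0 hC] := bl_bound bL.
exists (C + 1), d; split=> // [|q q' qd qd']; first by rewrite addr_gt0.
rewrite -[F q - F q'](subrK (L (q - q'))) addrC mulrDl.
by apply: le_trans (ler_normD _ _) _; rewrite lerD// h.
Qed.

Lemma nbhs_norm_ltP V (p : V) (P : V -> Prop) :
  (\forall q \near p, P q) <->
  exists2 d : R, 0 < d & forall q, `|q - p| < d -> P q.
Proof.
split.
  move=> /nbhs_normP[d /= d0 h]; exists d => // q qp; apply: h => /=.
  by rewrite distrC.
move=> [d d0 h]; apply/nbhs_normP; exists d => //= q qp; apply: h.
by rewrite distrC.
Qed.

Lemma strict_diff_continuous V W (F : V -> W) p L : strict_diff F p L ->
  {for p, continuous F}.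
Proof.
move=> /strict_diff_lipschitz[C [d [C0 d0 h]]].
apply/cvgrPdist_lt => e e0.
apply/nbhs_norm_ltP; exists (Num.min d (e / C)).
  by rewrite lt_min d0 divr_gt0.
move=> q; rewrite lt_min => /andP[qd qe]; rewrite distrC.
apply: le_lt_trans (h _ _ qd _) _; first by rewrite subrr normr0.
by rewrite mulrC -ltr_pdivlMr.
Qed.

Lemma strict_diff_is_diff V W (F : V -> W) p L : strict_diff F p L ->
  differentiable F p /\ 'd F p = L :> (V -> W).
Proof.
move=> sF; have [bL h] := sF; have [f Lf] := bl_linear bL.
have cf : continuous f by rewrite -Lf; exact: bl_continuous.
have eqo : F \o shift p = cst (F p) + f +o_ 0 id.
  apply/eqaddoP => e e0.
  have [d d0 hd] := h e e0.
  apply/nbhs_norm_ltP; exists d => // q; rewrite subr0 => qd.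
  rewrite -[X in `|X|]/(F (q + p) - (F p + f q)) opprD addrA.
  have := hd (q + p) p; rewrite addrK subrr normr0 -Lf; exact.
have df := diff_unique cf eqo.
split; last by rewrite df Lf.
by apply/diff_locallyP; rewrite df.
Qed.

Lemma strict_diff_near_eq V W (F G : V -> W) p L :
  (\forall q \near p, F q = G q) -> strict_diff F p L -> strict_diff G p L.
Proof.
move=> /nbhs_norm_ltP[d d0 hd] [bL h]; split=> // e e0.
have [d' d'0 h'] := h e e0; exists (Num.min d d'); first by rewrite lt_min d0.
move=> q q'; rewrite !lt_min => /andP[? ?] /andP[? ?].
by rewrite -!hd//; exact: h'.
Qed.

Lemma strict_diff_cst V W (c : W) p : strict_diff (fun _ : V => c) p (fun=> 0).
Proof.
split; first exact: bl_cst0.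
by move=> e e0; exists 1 => // q q' _ _; rewrite !subrr normr0 mulr_ge0// ltW.
Qed.

Lemma strict_diff_lin V W (L : V -> W) p : bounded_linear L -> strict_diff L p L.
Proof.
move=> bL; split=> // e e0; exists 1 => // q q' _ _.
by rewrite -blB// subrr normr0 mulr_ge0// ltW.
Qed.

Lemma strict_diff_add V W (F G : V -> W) p L M : strict_diff F p L -> strict_diff G p M ->
  strict_diff (fun v => F v + G v) p (fun v => L v + M v).
Proof.
move=> [bL hL] [bM hM]; split; first exact: bl_add.
move=> e e0; have e20 : 0 < e / 2 by rewrite divr_gt0.
have [d d0 hd] := hL _ e20; have [d' d'0 h'] := hM _ e20.
exists (Num.min d d'); first by rewrite lt_min d0.
move=> q q'; rewrite !lt_min => /andP[? ?] /andP[? ?].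
have -> : F q + G q - (F q' + G q') - (L (q - q') + M (q - q')) =
    (F q - F q' - L (q - q')) + (G q - G q' - M (q - q')).
  by rewrite !opprD (addrACA (F q)) (addrACA (F q - F q')).
apply: le_trans (ler_normD _ _) _.
by rewrite [in leRHS](splitr e) mulrDl lerD ?hd ?h'.
Qed.

Lemma strict_diff_comp V W (X : normedModType R) (G : W -> X) (F : V -> W) p L M :
  strict_diff F p L -> strict_diff G (F p) M ->
  strict_diff (fun v => G (F v)) p (fun v => M (L v)).
Proof.
move=> sF [bM hM]; have [bL hL] := sF; split; first exact: bl_comp.
move=> e e0.
have [C [d1 [C0 d10 hC]]] := strict_diff_lipschitz sF.
have [D D0 hD] := bl_bound bM.
have [d2 d20 h2] := hM (e / 2 / C) (divr_gt0 (divr_gt0 e0 (ltr0n _ 2)) C0).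
have [d3 d30 h3] := hL (e / 2 / D) (divr_gt0 (divr_gt0 e0 (ltr0n _ 2)) D0).
exists (Num.min d1 (Num.min (d2 / C) d3)).
  by rewrite !lt_min d10 d30 divr_gt0.
move=> q q'; rewrite !lt_min => /and3P[q1 q2 q3] /and3P[q1' q2' q3'].
have pd1 : `|p - p| < d1 by rewrite subrr normr0.
have Fq x : `|x - p| < d1 -> `|x - p| < d2 / C -> `|F x - F p| < d2.
  move=> x1 x2; apply: le_lt_trans (hC _ _ x1 pd1) _.
  by rewrite mulrC -ltr_pdivlMr.
have -> : G (F q) - G (F q') - M (L (q - q')) =
    (G (F q) - G (F q') - M (F q - F q')) + M (F q - F q' - L (q - q')).
  by rewrite (blB (F q - F q') _ bM) addrA subrK.
apply: le_trans (ler_normD _ _) _.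
rewrite [in leRHS](splitr e) mulrDl lerD//.
  apply: le_trans (h2 _ _ (Fq _ q1 q2) (Fq _ q1' q2')) _.
  have -> : e / 2 * `|q - q'| = e / 2 / C * (C * `|q - q'|).
    by rewrite [RHS]mulrA divfK// gt_eqF.
  by apply: ler_wpM2l; [rewrite !divr_ge0// ltW|exact: hC].
apply: le_trans (hD _) _.
by rewrite mulrC -ler_pdivlMr// mulrAC h3.
Qed.

Lemma strict_diff_pair V W (X : normedModType R) (F : V -> W) (G : V -> X) p L M :
  strict_diff F p L -> strict_diff G p M ->
  strict_diff (fun v => (F v, G v)) p (fun v => (L v, M v)).
Proof.
move=> [bL hL] [bM hM]; split; first exact: bl_pair.
move=> e e0; have [d d0 hd] := hL _ e0; have [d' d'0 h'] := hM _ e0.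
exists (Num.min d d'); first by rewrite lt_min d0.
move=> q q'; rewrite !lt_min => /andP[? ?] /andP[? ?].
by rewrite prod_normE ge_max /= hd// h'.
Qed.

(** The error splits into the errors of the two factors, each multiplied by
    the bounded other factor, and two terms where a linear increment meets a
    small variation of a factor. *)
Lemma strict_diff_mulmx V m n k (F : V -> 'M[R]_(m, n)) (G : V -> 'M[R]_(n, k)) p L M :
  strict_diff F p L -> strict_diff G p M ->
  strict_diff (fun v => F v *m G v) p (fun v => L v *m G p + F p *m M v).
Proof.
move=> sF sG; have [bL hL] := sF; have [bM hM] := sG; split.
  apply: bl_add.
    apply: (bl_comp (L := fun A => A *m G p)) => //; apply: bl_mx.
    by move=> a u v; rewrite mulmxDl scalemxAl.
  apply: (bl_comp (L := fun A => F p *m A)) => //; apply: bl_mx.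
  by move=> a u v; rewrite mulmxDr scalemxAr.
move=> e e0.
have [CF [d1 [CF0 d10 hF]]] := strict_diff_lipschitz sF.
have [CG [d2 [CG0 d20 hG]]] := strict_diff_lipschitz sG.
(* s absorbs the factor n of the product norm, and is positive also for n = 0 *)
pose s := (n%:R : R) + 1; have s0 : 0 < s by rewrite ltr_wpDl.
have ns (x y : R) : 0 <= x -> x <= y -> n%:R * x <= s * y.
  by move=> x0 xy; rewrite ler_pM// lerDl.
(* the two factors stay bounded near p *)
pose b := `|F p| + `|G p| + 1.
have b0 : 0 < b by rewrite ltr_wpDl// addr_ge0.
pose r := e / 4 / s / b.
have r0 : 0 < r by rewrite !divr_gt0.
have [d3 d30 h3] := hL r r0; have [d4 d40 h4] := hM r r0.
have [DL DL0 bdL] := bl_bound bL; have [DM DM0 bdM] := bl_bound bM.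
pose d5 := Num.min (1 / CF) (Num.min (1 / CG)
  (Num.min (e / 4 / s / DL / CG) (e / 4 / s / DM / CF))).
exists (Num.min d1 (Num.min d2 (Num.min d3 (Num.min d4 d5)))).
  by rewrite /d5 !lt_min d10 d20 d30 d40 !divr_gt0.
move=> q q'; rewrite /d5 !lt_min.
move=> /and5P[q1 q2 q3 q4 /and4P[q5 q6 q7 q8]].
move=> /and5P[q1' q2' q3' q4' /and4P[q5' q6' q7' q8']].
have pd1 : `|p - p| < d1 by rewrite subrr normr0.
have pd2 : `|p - p| < d2 by rewrite subrr normr0.
set v := q - q'.
have -> : F q *m G q - F q' *m G q' - (L v *m G p + F p *m M v) =
  (F q - F q' - L v) *m G q + L v *m (G q - G p)
  + F q' *m (G q - G q' - M v) + (F q' - F p) *m M v.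
  rewrite !(mulmxBl, mulmxBr) !opprD !addrA.
  set a1 := F q *m G q; set a2 := F q' *m G q; set a3 := L v *m G q.
  set a4 := L v *m G p; set a5 := F q' *m G q'; set a6 := F q' *m M v.
  set a7 := F p *m M v.
  apply/matrixP => i j; rewrite !mxE; lra.
have Gq : `|G q| <= b.
  rewrite -[G q](subrK (G p)); apply: le_trans (ler_normD _ _) _.
  have : `|G q - G p| <= 1.
    apply: le_trans (hG _ _ q2 pd2) _.
    by rewrite mulrC -ler_pdivlMr// ltW.
  by have := normr_ge0 (F p); rewrite /b; lra.
have Fq' : `|F q'| <= b.
  rewrite -[F q'](subrK (F p)); apply: le_trans (ler_normD _ _) _.
  have : `|F q' - F p| <= 1.
    apply: le_trans (hF _ _ q1' pd1) _.
    by rewrite mulrC -ler_pdivlMr// ltW.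
  by have := normr_ge0 (G p); rewrite /b; lra.
have -> : e * `|v| = e / 4 * `|v| + e / 4 * `|v| + e / 4 * `|v| + e / 4 * `|v|.
  by rewrite -!mulrDl; congr (_ * _); lra.
have key (A : 'M[R]_(m, n)) (B : 'M[R]_(n, k)) x y :
    0 <= x -> 0 <= y -> `|A| <= x -> `|B| <= y -> s * (x * y) <= e / 4 * `|v| ->
  `|A *m B| <= e / 4 * `|v|.
  move=> x0 y0 Ax By sxy; apply: le_trans (norm_mulmx_le _ _) _.
  by apply: le_trans sxy; apply: ns; rewrite ?mulr_ge0// ler_pM.
have v0 : 0 <= `|v| by [].
have sE : s != 0 by rewrite gt_eqF.
have bE : b != 0 by rewrite gt_eqF.
have DLE : DL != 0 by rewrite gt_eqF.
have DME : DM != 0 by rewrite gt_eqF.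
have CGE : CG != 0 by rewrite gt_eqF.
have CFE : CF != 0 by rewrite gt_eqF.
apply: le_trans (ler_normD _ _) _; rewrite lerD//.
  apply: le_trans (ler_normD _ _) _; rewrite lerD//.
    apply: le_trans (ler_normD _ _) _; rewrite lerD//.
      apply: (key _ _ _ _ (mulr_ge0 (ltW r0) v0) (ltW b0) (h3 _ _ q3 q3') Gq).
      by rewrite le_eqVlt; apply/orP; left; apply/eqP; rewrite /r; field; rewrite sE bE.
    have c0 : 0 < e / 4 / s / DL by rewrite !divr_gt0.
    apply: (key _ _ _ _ (mulr_ge0 (ltW DL0) v0) (ltW c0) (bdL _)).
      apply: le_trans (hG _ _ q2 pd2) _.
      by rewrite mulrC -ler_pdivlMr// ltW.
    by rewrite le_eqVlt; apply/orP; left; apply/eqP; field; rewrite sE DLE.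
  apply: (key _ _ _ _ (ltW b0) (mulr_ge0 (ltW r0) v0) Fq' (h4 _ _ q4 q4')).
  by rewrite le_eqVlt; apply/orP; left; apply/eqP; rewrite /r; field; rewrite sE bE.
have c0 : 0 < e / 4 / s / DM by rewrite !divr_gt0.
apply: (key _ _ _ _ (ltW c0) (mulr_ge0 (ltW DM0) v0) _ (bdM _)).
  apply: le_trans (hF _ _ q1' pd1) _.
  by rewrite mulrC -ler_pdivlMr// ltW.
by rewrite le_eqVlt; apply/orP; left; apply/eqP; field; rewrite sE DME.
Qed.

End StrictDiff.

(** * Mean values, and strict differentiability against continuous differentiability *)

Section MeanValue.
Context {R : realType}.
Implicit Types V W : normedModType R.

Lemma diff_bounded_linear V W (F : V -> W) p :
  differentiable F p -> bounded_linear ('d F p).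
Proof. by move=> dF; apply: continuous_bl; exact: diff_continuous. Qed.

Lemma is_diff_segment V (p v : V) (s : R) :
  is_diff s (fun r : R => p + r *: v) (fun r => r *: v).
Proof.
have bl : bounded_linear (fun r : R => r *: v).
  split; first by move=> a r r'; rewrite scalerDl scalerA.
  by exists `|v| => r; rewrite normrZ mulrC.
have sd : strict_diff (fun r : R => p + r *: v) s (fun r => 0 + r *: v).
  apply: strict_diff_add; first exact: strict_diff_cst.
  exact: (strict_diff_lin s bl).
have [d1 d2] := strict_diff_is_diff sd; apply: DiffDef => //.
by rewrite d2; apply/funext => r; rewrite add0r.
Qed.

(** The increment of a scalar function along a segment reduces to the mean
    value theorem on [0, 1]. *)
Lemma mvt_segment V (F : V -> R) p v :
  (forall s : R, 0 <= s <= 1 -> differentiable F (p + s *: v)) ->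
  exists2 s : R, 0 <= s <= 1 & F (p + v) - F p = 'd F (p + s *: v) v.
Proof.
move=> dF; pose phi (s : R) := F (p + s *: v).
have dphi (s : R) : 0 <= s <= 1 -> is_derive s 1 phi ('d F (p + s *: v) v).
  move=> s01; have dd := dF s s01.
  have idd : is_diff (p + s *: v) F ('d F (p + s *: v)) by apply: differentiableP.
  have ids := is_diff_segment p v s.
  have idc := is_diff_comp ids idd.
  apply: DeriveDef; first by apply: diff_derivable; case: idc.
  rewrite deriveE; last by case: idc.
  by rewrite diff_val /= scale1r.
have [||s s01] := @MVT R phi (fun s => 'd F (p + s *: v) v) 0 1 ltr01.
- by move=> s; rewrite in_itv /= => /andP[s0 s1]; apply: dphi; rewrite !ltW.
- apply: derivable_within_continuous => s; rewrite in_itv /= => s01.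
  by case: (dphi s s01).
- rewrite /phi subr0 mulr1 scale1r scale0r addr0 => ->.
  by exists s => //; move: s01; rewrite in_itv /= => /andP[s0 s1]; rewrite !ltW.
Qed.

Lemma segment_dist_lt V (p q q' : V) (d s : R) : 0 <= s <= 1 ->
  `|q - p| < d -> `|q' - p| < d -> `|q' + s *: (q - q') - p| < d.
Proof.
move=> /andP[s0 s1] qd qd'.
have -> : q' + s *: (q - q') - p = s *: (q - p) + (1 - s) *: (q' - p).
  rewrite scalerBl scale1r addrCA -scalerBr opprB (addrA (q - p)) subrK.
  by rewrite addrAC.
apply: le_lt_trans (ler_normD _ _) _.
rewrite !normrZ (ger0_norm s0) ger0_norm ?subr_ge0//.
have [s0'|s0'] := eqVneq s 0; first by rewrite s0' mul0r add0r subr0 mul1r.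
have sp : 0 < s by rewrite lt_neqAle eq_sym s0'.
have h1 : s * `|q - p| < s * d by rewrite ltr_pM2l.
have h2 : (1 - s) * `|q' - p| <= (1 - s) * d.
  by rewrite ler_wpM2l ?subr_ge0// ltW.
lra.
Qed.

(** No mean value equality holds for vector values; the bound is proved
    entry by entry, which costs nothing for the sup norm. *)
Lemma mean_value_mx V m n (F : V -> 'M[R]_(m, n)) p v (L : V -> 'M[R]_(m, n)) e :
  0 <= e ->
  (forall s : R, 0 <= s <= 1 -> differentiable F (p + s *: v) /\
     `|'d F (p + s *: v) v - L v| <= e * `|v|) ->
  `|F (p + v) - F p - L v| <= e * `|v|.
Proof.
move=> e0 h; apply: mx_norm_le => [|i j]; first by rewrite mulr_ge0.
pose c (M : 'M[R]_(m, n)) : R := M i j.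
have blc : bounded_linear c by apply: bl_mx => a u w; rewrite /c !mxE.
have dcF (s : R) : 0 <= s <= 1 ->
    is_diff (p + s *: v) (c \o F) (c \o 'd F (p + s *: v)).
  move=> s01; have [dF _] := h s s01.
  have [d1 d2] := strict_diff_is_diff (strict_diff_lin (F (p + s *: v)) blc).
  apply: is_diff_comp; first exact: differentiableP.
  by apply: DiffDef.
have [|s s01 E] := @mvt_segment V (c \o F) p v.
  by move=> s s01; case: (dcF s s01).
have := dcF s s01 => -[_ d2]; rewrite d2 in E.
have [_ hs] := h s s01; apply: le_trans hs.
rewrite !mxE; apply: le_trans (le_coord_norm _ i j).
by rewrite !mxE; move: E; rewrite /= /c => ->.
Qed.

(** Operator-norm continuity of the differential follows from continuity on
    the finitely many basis vectors. *)
Lemma C1_at_uniform a b m n (F : 'rV[R]_a * 'rV[R]_b -> 'M[R]_(m, n)) p :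
  C1_at F p -> forall e : R, 0 < e -> exists2 d : R, 0 < d & forall q,
    `|q - p| < d -> differentiable F q /\
      forall v, `|'d F q v - 'd F p v| <= e * `|v|.
Proof.
move=> [dF cF] e e0.
have dFp : differentiable F p := nbhs_singleton dF.
pose e1 : R := e / (a%:R + b%:R + 1).
have N0 : 0 < a%:R + b%:R + 1 :> R by rewrite ltr_wpDl// addr_ge0.
have e10 : 0 < e1 by rewrite divr_gt0.
have hn v : \forall q \near p, `|'d F q v - 'd F p v| <= e1.
  have /cvgrPdist_le /(_ _ e10) hc := cF v.
  apply: filterS hc => q hq.
  rewrite -normrN opprB.
  exact: hq.
have h1 : \forall q \near p, forall i : 'I_a,
    `|'d F q (delta_mx 0 i, 0) - 'd F p (delta_mx 0 i, 0)| <= e1.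
  exact: (filter_forall _ (fun i => hn (delta_mx 0 i, 0))).
have h2 : \forall q \near p, forall i : 'I_b,
    `|'d F q (0, delta_mx 0 i) - 'd F p (0, delta_mx 0 i)| <= e1.
  exact: (filter_forall _ (fun i => hn (0, delta_mx 0 i))).
have [d d0 hd] := (nbhs_norm_ltP _ _).1 (filterI dF (filterI h1 h2)).
exists d; first exact: d0.
move=> q /hd[dFq [k1 k2]]; split; first exact: dFq.
move=> -[v1 v2].
have bq := diff_bounded_linear dFq; have bp := diff_bounded_linear dFp.
pose D (v : 'rV[R]_a * 'rV[R]_b) := 'd F q v + (-1) *: 'd F p v.
have bD : bounded_linear D by exact: (bl_add bq (bl_scale (-1) bp)).
have DE v : 'd F q v - 'd F p v = D v by rewrite /D scaleN1r.
have l1 : linear (fun u : 'rV[R]_a => D (u, 0)).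
  move=> c u w; rewrite -(blZ _ _ bD) -(blD _ _ bD); congr (D (_, _)).
  by rewrite /= scaler0 addr0.
have l2 : linear (fun u : 'rV[R]_b => D (0, u)).
  move=> c u w; rewrite -(blZ _ _ bD) -(blD _ _ bD); congr (D (_, _)).
  by rewrite /= scaler0 addr0.
rewrite DE; have -> : (v1, v2) = (v1, 0) + (0, v2).
  by congr (_, _); rewrite ?addr0 ?add0r.
rewrite (blD _ _ bD); apply: le_trans (ler_normD _ _) _.
have := linear_mx_norm_le v1 l1; rewrite big_ord1 => n1.
have := linear_mx_norm_le v2 l2; rewrite big_ord1 => n2.
have s1 : \sum_j `|D (delta_mx 0 j, 0)| <= a%:R * e1.
  rewrite -[a in leRHS]card_ord -sumr_const mulr_suml ler_sum// => j _.
  by rewrite mul1r -DE.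
have s2 : \sum_j `|D (0, delta_mx 0 j)| <= b%:R * e1.
  rewrite -[b in leRHS]card_ord -sumr_const mulr_suml ler_sum// => j _.
  by rewrite mul1r -DE.
have nv1 : `|v1| <= `|(v1, v2)| by rewrite prod_normE le_max lexx.
have nv2 : `|v2| <= `|(v1, v2)| by rewrite prod_normE le_max lexx orbT.
have -> : (v1, 0) + (0, v2) = (v1, v2).
  by congr (_, _); rewrite ?addr0 ?add0r.
apply: (@le_trans _ _ (a%:R * e1 * `|(v1, v2)| + b%:R * e1 * `|(v1, v2)|)).
  apply: lerD.
    apply: le_trans n1 _; apply: ler_pM => //; exact: sumr_ge0.
  apply: le_trans n2 _; apply: ler_pM => //; exact: sumr_ge0.
rewrite -mulrDl -mulrDl ler_wpM2r// /e1 mulrCA ger_pMr//.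
by rewrite ler_pdivrMr// mul1r lerDl.
Qed.

Lemma C1_at_strict_diff a b m n (F : 'rV[R]_a * 'rV[R]_b -> 'M[R]_(m, n)) p :
  C1_at F p -> strict_diff F p ('d F p).
Proof.
move=> C1F; have dFp := nbhs_singleton (proj1 C1F).
split=> [|e e0]; first exact: diff_bounded_linear.
have [d d0 hd] := C1_at_uniform C1F e0; exists d => // q q' qd qd'.
have := @mean_value_mx _ m n F q' (q - q') ('d F p) e (ltW e0).
have -> : q' + (q - q') = q by rewrite addrC subrK.
apply=> s s01; have [dF hF] := hd _ (segment_dist_lt s01 qd qd').
by split; [exact: dF|exact: hF].
Qed.

(** Near p the expansions at q and at p both describe the increment of F
    over a short multiple of v, so their linear parts almost agree. *)
Lemma strict_diff_close V W (F : V -> W) p L (e : R) : strict_diff F p L -> 0 < e ->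
  exists2 d : R, 0 < d & forall q M, `|q - p| < d -> strict_diff F q M ->
    forall v, `|M v - L v| <= e * `|v|.
Proof.
move=> [bL hL] e0; have e20 : 0 < e / 2 by rewrite divr_gt0.
have [d d0 hd] := hL _ e20; exists d => // q M qd [bM hM] v.
have [d' d'0 hd'] := hM _ e20.
(* s v is short enough for both first-order expansions *)
have v10 : 0 < `|v| + 1 by rewrite ltr_wpDl.
have m0 : 0 < Num.min d' (d - `|q - p|) by rewrite lt_min d'0 subr_gt0.
have [s s0 sv] : exists2 s : R, 0 < s & s * `|v| < Num.min d' (d - `|q - p|).
  exists (Num.min d' (d - `|q - p|) / (`|v| + 1)); first by rewrite divr_gt0.
  by rewrite mulrAC ltr_pdivrMr// ltr_pM2l// ltrDl.
have /andP[sv1 sv2] : (s * `|v| < d') && (s * `|v| < d - `|q - p|).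
  by rewrite -lt_min.
have nsv : `|s *: v| = s * `|v| by rewrite normrZ gtr0_norm.
have A := hd (q + s *: v) q.
have B := hd' (q + s *: v) q.
have E : q + s *: v - q = s *: v by rewrite addrAC subrr add0r.
rewrite E in A B.
have {}A : `|F (q + s *: v) - F q - L (s *: v)| <= e / 2 * `|s *: v|.
  apply: A => //; rewrite addrAC; apply: le_lt_trans (ler_normD _ _) _.
  by rewrite nsv -ltrBDl.
have {}B : `|F (q + s *: v) - F q - M (s *: v)| <= e / 2 * `|s *: v|.
  by apply: B; rewrite ?E ?nsv// subrr normr0.
have : `|M (s *: v) - L (s *: v)| <= e * `|s *: v|.
  set X := F (q + s *: v) - F q in A B.
  have -> : M (s *: v) - L (s *: v) = (X - L (s *: v)) - (X - M (s *: v)).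
    by rewrite opprB [RHS]addrC addrA subrK.
  rewrite (splitr e) mulrDl; apply: le_trans (ler_normB _ _) _.
  exact: lerD.
rewrite (blZ _ _ bM) (blZ _ _ bL) -scalerBr.
rewrite !normrZ (gtr0_norm s0) (mulrCA e).
by rewrite ler_pM2l.
Qed.

(** [strict_diff_close] turns strict differentiability on a neighbourhood
    into the continuity of the differential. *)
Lemma strict_diff_C1_at V W (F : V -> W) p :
  (\forall q \near p, exists L, strict_diff F q L) -> C1_at F p.
Proof.
move=> sF; split.
  by apply: filterS sF => q [L /strict_diff_is_diff[]].
move=> v; have [L sL] := nbhs_singleton sF.
have [_ dL] := strict_diff_is_diff sL.
apply/cvgrPdist_le => e e0.
have v10 : 0 < `|v| + 1 by rewrite ltr_wpDl.
have [d d0 hd] := strict_diff_close sL (divr_gt0 e0 v10).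
have : \forall q \near p, `|q - p| < d by apply/nbhs_norm_ltP; exists d.
move=> near_d; apply: filterS (filterI sF near_d) => q [[M sM] qd].
have [_ dM] := strict_diff_is_diff sM; rewrite dM dL distrC.
apply: le_trans (hd _ _ qd sM v) _.
by rewrite mulrAC ler_pdivrMr// ler_wpM2l ?ltW// ltrDl.
Qed.

End MeanValue.

(** * Branches of local minimizers *)

Section Implicit.
Context {R : realType} {N : nat}.
Implicit Types T : normedModType R.

(** In equal finite dimensions injectivity gives an inverse, whose bound is
    the lower bound on M. *)
Lemma bl_injective_inverse (M : 'rV[R]_N -> 'rV[R]_N) :
  bounded_linear M -> (forall v, M v = 0 -> v = 0) ->
  exists S, [/\ bounded_linear S, forall w, M (S w) = w &
    exists2 c : R, 0 < c & forall v, c * `|v| <= `|M v|].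
Proof.
move=> bM injM; have [f Mf] := bl_linear bM.
pose A := lin1_mx f.
have MA v : M v = v *m A by rewrite /A mul_rV_lin1 Mf.
have Au : A \in unitmx.
  rewrite -row_free_unit; apply: inj_row_free => v.
  by rewrite -MA; exact: injM.
have bS : bounded_linear (fun w : 'rV[R]_N => w *m invmx A).
  by apply: bl_mx => a u v; rewrite mulmxDl scalemxAl.
exists (fun w => w *m invmx A); split=> [//|w|].
  by rewrite MA mulmxKV.
have [C C0 hC] := bl_bound bS.
exists C^-1; first by rewrite invr_gt0.
move=> v; rewrite -[v in leLHS](mulmxK Au) -MA.
by rewrite ler_pdivrMl.
Qed.

Lemma norm_pair_lt (T U : normedModType R) (t t0 : T) (y y0 : U) (d : R) :
  `|t - t0| < d -> `|y - y0| < d -> `|(t, y) - (t0, y0)| < d.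
Proof. by move=> h1 h2; rewrite prod_normE gt_max h1 h2. Qed.

Lemma norm_pair0 (T U : normedModType R) (y : U) : `|(0 : T, y)| = `|y|.
Proof. by rewrite prod_normE normr0 max_r. Qed.

Lemma bl_partial2 (T U W : normedModType R) (D : T * U -> W) :
  bounded_linear D -> bounded_linear (fun u => D (0, u)).
Proof.
by move=> bD; apply: (bl_comp bD); apply: bl_pair; [exact: bl_cst0|exact: bl_id].
Qed.

Lemma bl_partial1 (T U W : normedModType R) (D : T * U -> W) :
  bounded_linear D -> bounded_linear (fun t => D (t, 0)).
Proof.
by move=> bD; apply: (bl_comp bD); apply: bl_pair; [exact: bl_id|exact: bl_cst0].
Qed.

Lemma bl_split (T U W : normedModType R) (D : T * U -> W) t u :
  bounded_linear D -> D (t, u) = D (t, 0) + D (0, u).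
Proof.
by move=> bD; rewrite -(blD _ _ bD); congr (D (_, _)); rewrite ?addr0 ?add0r.
Qed.

Section Estimate.
Context {T : normedModType R}.
Variables (K : T * 'rV[R]_N -> 'rV[R]_N) (t0 : T) (y0 : 'rV[R]_N).
Variable D : T * 'rV[R]_N -> 'rV[R]_N.
Hypothesis sK : strict_diff K (t0, y0) D.
Hypothesis injD : forall v, D (0, v) = 0 -> v = 0.

(** For two zeros the expansion reads D (t - t', y - y') = o, and the lower
    bound on D (0, _) absorbs the part of the error coming from y - y'.  With
    t = t' this is local uniqueness. *)
Lemma implicit_lipschitz : exists C d : R, [/\ 0 < C, 0 < d &
  forall t t' y y', `|t - t0| < d -> `|t' - t0| < d ->
    `|y - y0| < d -> `|y' - y0| < d -> K (t, y) = 0 -> K (t', y') = 0 ->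
    `|y - y'| <= C * `|t - t'|].
Proof.
have [bD hD] := sK.
have [S [bS _ [c c0 hc]]] := bl_injective_inverse (bl_partial2 bD) injD.
have [C C0 hC] := bl_bound (bl_partial1 bD).
have c20 : 0 < c / 2 by rewrite divr_gt0.
have [d d0 hd] := hD _ c20.
exists ((C + c / 2) / (c / 2)), d; split=> //; first by rewrite divr_gt0 ?addr_gt0.
move=> t t' y y' td td' yd yd' K0 K0'.
have := hd (t, y) (t', y') (norm_pair_lt td yd) (norm_pair_lt td' yd').
rewrite K0 K0' subrr sub0r normrN (_ : (t, y) - (t', y') = (t - t', y - y'))//.
rewrite (bl_split _ _ bD) => h.
have h1 := hc (y - y'); have h2 := hC (t - t').
have h3 : `|D (0, y - y')| <= `|D (t - t', 0) + D (0, y - y')| + `|D (t - t', 0)|.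
  rewrite -[X in `|X| <= _](addrK (D (t - t', 0))) [X in `|X - _|]addrC.
  exact: ler_normB.
have h4 : `|(t - t', y - y')| <= `|t - t'| + `|y - y'|.
  by rewrite prod_normE ge_max lerDl lerDr !normr_ge0.
have h5 : c / 2 * `|(t - t', y - y')| <= c / 2 * (`|t - t'| + `|y - y'|).
  by rewrite ler_wpM2l// ltW.
rewrite mulrAC ler_pdivlMr//.
by lra.
Qed.

(** The derivative L v is the solution of D (v, L v) = 0; the lower bound on
    D (0, _) transfers the expansion error of K to Y, once the Lipschitz bound
    makes it an o(q - q'). *)
Lemma implicit_strict_diff (Y : T -> 'rV[R]_N) :
  Y t0 = y0 -> {for t0, continuous Y} -> (\forall t \near t0, K (t, Y t) = 0) ->
  exists2 L, strict_diff Y t0 L & forall v, D (v, L v) = 0.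
Proof.
move=> Y0 cY KY; have [bD hD] := sK.
have b2 := bl_partial2 bD; have b1 := bl_partial1 bD.
have [S [bS DS [c c0 hc]]] := bl_injective_inverse b2 injD.
pose L v := (-1) *: S (D (v, 0)).
have DL v : D (v, L v) = 0.
  by rewrite (bl_split _ _ bD) (blZ _ _ b2) DS scaleN1r subrr.
exists L => //; split; first exact: (bl_scale (-1) (bl_comp bS b1)).
move=> e e0.
have [C [d1 [C0 d10 hC]]] := implicit_lipschitz.
have e'0 : 0 < e * c / (1 + C) by rewrite divr_gt0 ?mulr_gt0 ?addr_gt0.
have [d2 d20 h2] := hD _ e'0.
have [d3 d30 h3] := (nbhs_norm_ltP _ _).1 KY.
have m0 : 0 < Num.min d1 d2 by rewrite lt_min d10.
have [d4 d40 h4] : exists2 d : R, 0 < d &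
    forall t, `|t - t0| < d -> `|Y t - y0| < Num.min d1 d2.
  apply/nbhs_norm_ltP; move/cvgrPdist_lt: cY => /(_ _ m0).
  by rewrite Y0; apply: filterS => t; rewrite distrC.
exists (Num.min (Num.min d1 d2) (Num.min d3 d4)).
  by rewrite !lt_min d10 d20 d30 d40.
move=> q q'; rewrite !lt_min.
move=> /andP[/andP[q1 q2] /andP[q3 q4]] /andP[/andP[q1' q2'] /andP[q3' q4']].
have := h4 q q4; rewrite lt_min => /andP[y1 y2].
have := h4 q' q4'; rewrite lt_min => /andP[y1' y2'].
have Kq := h3 q q3; have Kq' := h3 q' q3'.
have lip := hC _ _ _ _ q1 q1' y1 y1' Kq Kq'.
have := h2 (q, Y q) (q', Y q') (norm_pair_lt q2 y2) (norm_pair_lt q2' y2').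
rewrite Kq Kq' subrr sub0r normrN (_ : (q, Y q) - (q', Y q') = (q - q', Y q - Y q'))//.
set v := q - q' => h.
set w := Y q - Y q' - L v.
have Dw : D (0, w) = D (v, Y q - Y q').
  rewrite (bl_split v _ bD) [LHS](blB _ _ b2) addrC; congr (_ + _).
  have := DL v; rewrite (bl_split _ _ bD) => /eqP.
  by rewrite addr_eq0 => /eqP ->; rewrite ?opprK.
have := hc w; rewrite Dw => hw.
have h5 : `|(v, Y q - Y q')| <= (1 + C) * `|v|.
  rewrite prod_normE ge_max /= mulrDl mul1r; apply/andP; split.
    by rewrite lerDl mulr_ge0// ltW.
  by apply: le_trans lip _; rewrite lerDr.
rewrite -(ler_pM2l c0); apply: le_trans hw (le_trans h _).
apply: (@le_trans _ _ (e * c / (1 + C) * ((1 + C) * `|v|))).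
  by rewrite ler_wpM2l// ltW.
have C1 : 1 + C != 0 by rewrite gt_eqF// addr_gt0.
by rewrite mulrA divfK// mulrAC mulrC mulrA.
Qed.

End Estimate.

(** Fermat's rule, from its one-dimensional version along each line. *)
Lemma diff_local_min (F : 'rV[R]_N -> R) y (G : 'rV[R]_N) :
  (forall x, differentiable F x) -> (forall v, 'd F y v = (G *m v^T) 0 0) ->
  (\forall x \near y, F y <= F x) -> G = 0.
Proof.
move=> dF dFE /nbhs_norm_ltP[d d0 hd].
suff d0v v : 'd F y v = 0.
  apply/rowP => j; have := d0v (delta_mx 0 j).
  by rewrite dFE trmx_delta -colE !mxE.
have v10 : 0 < `|v| + 1 by rewrite ltr_wpDl.
pose phi (s : R) := F (y + s *: v).
have iphi (s : R) : is_diff s phi (fun r => 'd F (y + s *: v) (r *: v)).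
  apply: (is_diff_comp (is_diff_segment y v s)); exact: differentiableP.
have dphi (s : R) : derivable phi s 1 by apply: diff_derivable; case: (iphi s).
pose s := d / (`|v| + 1); have s0 : 0 < s by rewrite divr_gt0.
have h0 : 0 \in `](- s), s[ by rewrite in_itv /= oppr_lt0 s0.
have ss : - s < s by lra.
have := @derive1_at_min R phi (- s) s 0 (ltW ss) (fun t _ => dphi t) h0.
case.
  move=> t; rewrite in_itv /= -ltr_norml => ts.
  rewrite /phi scale0r addr0; apply: hd.
  rewrite addrAC subrr add0r normrZ.
  apply: (@le_lt_trans _ _ (`|t| * (`|v| + 1))).
    by rewrite ler_wpM2l// lerDl.
  by rewrite -ltr_pdivlMr.
move=> _; rewrite deriveE; last by case: (iphi 0).
by have [_ ->] := iphi 0; rewrite scale1r scale0r addr0.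
Qed.

Lemma continuous_dist (V : normedModType R) (a : V) :
  continuous (fun y : V => `|y - a|).
Proof.
move=> y; apply/cvgrPdist_lt => e e0; apply/nbhs_norm_ltP; exists e => // x xy.
apply: le_lt_trans (ler_dist_dist _ _) _.
by rewrite opprB addrA subrK distrC.
Qed.

Section Branch.
Context {T : normedModType R}.
Variables (F : T -> 'rV[R]_N -> R) (K : T * 'rV[R]_N -> 'rV[R]_N).
Variable D : T * 'rV[R]_N -> T * 'rV[R]_N -> 'rV[R]_N.
Hypothesis dF : forall t y, differentiable (F t) y.
Hypothesis dFE : forall t y v, 'd (F t) y v = (K (t, y) *m v^T) 0 0.
Hypothesis sK : forall p, strict_diff K p (D p).
Variables (theta : T) (y0 : 'rV[R]_N).
Hypothesis injD : forall v, D (theta, y0) (0, v) = 0 -> v = 0.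
Hypothesis min0 : \forall y \near y0, F theta y0 <= F theta y.

(** A point of no larger value close to y0 is again a local minimizer, hence
    a zero of the gradient, and zeros are isolated. *)
Lemma strict_local_min : exists2 d : R, 0 < d & forall y, `|y - y0| < d ->
  F theta y <= F theta y0 -> y = y0.
Proof.
have [d d0 hd] := (nbhs_norm_ltP _ _).1 min0.
have [C [d1 [C0 d10 hC]]] := implicit_lipschitz (sK _) injD.
exists (Num.min d d1); first by rewrite lt_min d0.
move=> y; rewrite lt_min => /andP[yd yd1] Fy.
have K0 : K (theta, y0) = 0.
  exact: (diff_local_min (dF theta) (dFE theta y0) min0).
have Ky : K (theta, y) = 0.
  apply: (diff_local_min (dF theta) (dFE theta y)).
  apply/nbhs_norm_ltP; exists (d - `|y - y0|); first by rewrite subr_gt0.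
  move=> x xd; apply: le_trans Fy _; apply: hd.
  rewrite -(subrK y x) -addrA; apply: le_lt_trans (ler_normD _ _) _.
  by rewrite -ltrBrDr.
have := hC theta theta y y0; rewrite !subrr !normr0 mulr0 => /(_ d10 d10 yd1 d10 Ky K0).
by rewrite normr_le0 subr_eq0 => /eqP.
Qed.

(** Only the gradient is controlled as t varies, so it is the increments of
    F t that are compared with those of F theta, by a mean value argument:
    F t itself may be discontinuous in t. *)
Lemma increment_close t (y : 'rV[R]_N) (e : R) :
  (forall x, `|x - y0| <= `|y - y0| -> `|K (t, x) - K (theta, x)| <= e) ->
  `|(F t y - F t y0) - (F theta y - F theta y0)| <= N%:R * (e * `|y - y0|).
Proof.
move=> hK; pose G x := F t x - F theta x.
have dG x : is_diff x G (fun v => 'd (F t) x v - 'd (F theta) x v).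
  by apply: is_diffB; apply: differentiableP; exact: dF.
have [|s s01] := @mvt_segment R _ G y0 (y - y0).
  by move=> s _; case: (dG (y0 + s *: (y - y0))).
have -> : y0 + (y - y0) = y by rewrite addrC subrK.
pose x := y0 + s *: (y - y0); have [_ dGE] := dG x.
rewrite -/x dGE !dFE => E.
have -> : F t y - F t y0 - (F theta y - F theta y0) = G y - G y0.
  by rewrite /G; lra.
rewrite E; have -> : forall A B : 'M[R]_1, A 0 0 - B 0 0 = (A - B) 0 0.
  by move=> A B; rewrite !mxE.
rewrite -mulmxBl; apply: le_trans (le_coord_norm _ _ _) _.
apply: le_trans (norm_mulmx_le _ _) _; rewrite ler_wpM2l//.
apply: ler_pM => //.
  apply: hK; rewrite /x addrAC subrr add0r normrZ.
  by case/andP: s01 => s0 s1; rewrite ger0_norm// ler_piMl.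
by apply: mx_norm_le => // i j; rewrite mxE le_coord_norm.
Qed.

Lemma continuous_F t : continuous (F t).
Proof. by move=> y; apply: differentiable_continuous; exact: dF. Qed.

Lemma compact_closed_ball_rV (r : R) : compact [set y : 'rV[R]_N | `|y - y0| <= r].
Proof.
apply: bounded_closed_compact.
  exists (`|y0| + r); split; first exact: num_real.
  move=> x x0 y /= yr; apply: ltW; apply: le_lt_trans x0.
  rewrite -[y](subrK y0); apply: le_trans (ler_normD _ _) _.
  by rewrite addrC lerD2l.
rewrite (_ : mkset _ = (fun y => `|y - y0|) @^-1` [set x | x <= r])//.
apply: closed_comp; last exact: closed_le.
by move=> y _; exact: continuous_dist.
Qed.

(** Compactness of the sphere; the sphere is empty when N = 0, where any gap
    will do. *)
Lemma sphere_gap (r : R) : 0 < r ->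
  (forall y, `|y - y0| = r -> F theta y0 < F theta y) ->
  exists2 e : R, 0 < e & forall y, `|y - y0| = r -> F theta y0 + e <= F theta y.
Proof.
move=> r0 h; pose S := [set y : 'rV[R]_N | `|y - y0| = r].
have [[y1 Sy1]|S0] := pselect (S !=set0); last first.
  by exists 1 => // y Sy; exfalso; apply: S0; exists y.
have cS : compact S.
  apply: (@subclosed_compact _ _ [set y : 'rV[R]_N | `|y - y0| <= r]).
  - rewrite (_ : S = (fun y => `|y - y0|) @^-1` [set x | x = r])//.
    apply: closed_comp; last exact: closed_eq.
    by move=> y _; exact: continuous_dist.
  - exact: compact_closed_ball_rV.
  - by move=> y /= ->.
have [||c cS' hc] := @compact_EVT_min _ R (F theta) S _ cS.
- by exists y1.
- by apply: continuous_subspaceT; exact: continuous_F.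
move: cS'; rewrite inE => /= cS'.
exists (F theta c - F theta y0); first by rewrite subr_gt0 h.
by move=> y Sy; rewrite addrC subrK; apply: hc; rewrite inE.
Qed.

Theorem local_min_branch : exists2 r : R, 0 < r & exists2 Y : T -> 'rV[R]_N,
  Y theta = y0 &
  \forall t \near theta, [/\ `|Y t - y0| < r /\ K (t, Y t) = 0,
    forall y, `|y - y0| < r -> K (t, y) = 0 -> y = Y t,
    \forall y \near Y t, F t (Y t) <= F t y &
    exists2 L, strict_diff Y t L & forall v, D (t, Y t) (v, L v) = 0].
Proof.
have sK0 := sK (theta, y0); have [bD0 _] := sK0.
have [S [_ _ [c c0 hc]]] := bl_injective_inverse (bl_partial2 bD0) injD.
have [d1 d10 h1] := strict_local_min.
have [C [d2 [C0 d20 h2]]] := implicit_lipschitz sK0 injD.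
have [CK [d3 [CK0 d30 h3]]] := strict_diff_lipschitz sK0.
have c20 : 0 < c / 2 by rewrite divr_gt0.
have [d4 d40 h4] := strict_diff_close sK0 c20.
pose m := Num.min (Num.min d1 d2) (Num.min d3 d4).
have m0 : 0 < m by rewrite !lt_min d10 d20 d30 d40.
pose r : R := m / 2; have r0 : 0 < r by rewrite divr_gt0.
have rm : r < m by rewrite ltr_pdivrMr// ltr_pMr// ltr1n.
have [r1 r2 r3 r4] : [/\ r < d1, r < d2, r < d3 & r < d4].
  by move: rm; rewrite !lt_min => /andP[/andP[? ?] /andP[? ?]].
have [e e0 he] : exists2 e : R, 0 < e &
    forall y, `|y - y0| = r -> F theta y0 + e <= F theta y.
  apply: sphere_gap => // y yr; rewrite ltNge; apply/negP => Fy.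
  have := h1 y; rewrite yr => /(_ r1 Fy) yy0.
  by move: r0; rewrite -yr yy0 subrr normr0 ltxx.
pose dt := Num.min (Num.min d2 (Num.min d3 d4)) (e / (N%:R * r + 1) / CK).
have Nr0 : 0 < N%:R * r + 1 by rewrite ltr_wpDl// mulr_ge0// ltW.
have dt0 : 0 < dt by rewrite !lt_min d20 d30 d40 !divr_gt0.
pose P t y := [/\ `|y - y0| < r, K (t, y) = 0 & \forall x \near y, F t y <= F t x].
(* the minimum over the closed ball avoids its boundary: dt is chosen so that
   increments of F t and F theta differ there by less than the gap e *)
have exP t : `|t - theta| < dt -> exists y, P t y.
  rewrite !lt_min => /andP[/and3P[t2 t3 t4] t5].
  have [||y yB hy] := @compact_EVT_min _ R (F t) [set y | `|y - y0| <= r] _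
    (@compact_closed_ball_rV r).
  - by exists y0; rewrite /= subrr normr0 ltW.
  - by apply: continuous_subspaceT; exact: continuous_F.
  move: yB; rewrite inE /= => yB; exists y.
  have yr : `|y - y0| < r.
    rewrite lt_neqAle yB andbT; apply/eqP => yr.
    have : F t y <= F t y0 by apply: hy; rewrite inE /= subrr normr0 ltW.
    have hK x : `|x - y0| <= `|y - y0| ->
        `|K (t, x) - K (theta, x)| <= CK * `|t - theta|.
      rewrite yr => xr; have xd3 : `|x - y0| < d3 by apply: le_lt_trans r3.
      have := h3 (t, x) (theta, x).
      rewrite (_ : (t, x) - (theta, x) = (t - theta, x - x))// subrr.
      rewrite [`|(t - theta, 0)|]prod_normE normr0 max_l//; apply.
        exact: norm_pair_lt.
      by apply: norm_pair_lt; rewrite // subrr normr0.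
    have := increment_close hK; rewrite yr.
    have b : N%:R * (CK * `|t - theta| * r) < e.
      move: t5; rewrite ltr_pdivlMr// ltr_pdivlMr// => t5; apply: le_lt_trans t5.
      rewrite mulrDr mulr1 [CK * _]mulrC mulrCA lerDl mulr_ge0//.
      by rewrite ltW.
    by have := he y yr; rewrite ler_norml => ? /andP[]; lra.
  have my : \forall x \near y, F t y <= F t x.
    apply/nbhs_norm_ltP; exists (r - `|y - y0|); first by rewrite subr_gt0.
    move=> x xy; apply: hy; rewrite inE /= -(subrK y x) -addrA.
    by apply: le_trans (ler_normD _ _) _; rewrite -lerBrDr ltW.
  split=> //; exact: (diff_local_min (dF t) (dFE t y) my).
pose Y t := xget y0 (P t).
have PY t : `|t - theta| < dt -> P t (Y t).
  by move=> /exP[y Py]; exact: (xgetI y0 Py).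
have dt2 t : `|t - theta| < dt -> `|t - theta| < d2.
  by rewrite !lt_min => /andP[/andP[]].
have dt4 t : `|t - theta| < dt -> `|t - theta| < d4.
  by rewrite !lt_min => /andP[/and3P[]].
have lipY t t' y y' : `|t - theta| < dt -> `|t' - theta| < dt ->
    `|y - y0| < r -> `|y' - y0| < r -> K (t, y) = 0 -> K (t', y') = 0 ->
    `|y - y'| <= C * `|t - t'|.
  by move=> /dt2 ? /dt2 ? ? ?; apply: h2 => //; apply: lt_trans r2.
have uniqY t y y' : `|t - theta| < dt -> `|y - y0| < r -> `|y' - y0| < r ->
    K (t, y) = 0 -> K (t, y') = 0 -> y = y'.
  move=> td yr yr' Ky Ky'; have := lipY t t y y' td td yr yr' Ky Ky'.
  by rewrite subrr normr0 mulr0 normr_le0 subr_eq0 => /eqP.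
have th0 : `|theta - theta| < dt by rewrite subrr normr0.
have near_dt : \forall t \near theta, `|t - theta| < dt.
  by apply/nbhs_norm_ltP; exists dt.
have y0r : `|y0 - y0| < r by rewrite subrr normr0.
exists r => //; exists Y.
  have [Yr KY _] := PY _ th0; apply: (uniqY theta) => //.
  exact: (diff_local_min (dF theta) (dFE theta y0) min0).
apply: filterS near_dt => t td; have [Yr KY mY] := PY _ td.
split=> // [y yr Ky|]; first exact: (uniqY t).
have near_t : \forall s \near t, `|s - theta| < dt.
  apply/nbhs_norm_ltP; exists (dt - `|t - theta|); first by rewrite subr_gt0.
  move=> s st; rewrite -(subrK t s) -addrA.
  by apply: le_lt_trans (ler_normD _ _) _; rewrite -ltrBrDr.
apply: (implicit_strict_diff (sK (t, Y t))) => [|//||].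
- move=> v Dv; have tY4 : `|(t, Y t) - (theta, y0)| < d4.
    by apply: norm_pair_lt; [exact: dt4|exact: lt_trans r4].
  have := h4 _ _ tY4 (sK _) (0, v); rewrite Dv sub0r normrN norm_pair0.
  move=> hv; have := hc v => hcv; apply/eqP; rewrite -normr_le0.
  have : c / 2 * `|v| <= 0 by lra.
  by rewrite pmulr_rle0.
- apply/cvgrPdist_lt => x x0; apply/nbhs_norm_ltP.
  have [d5 d50 h5] := (nbhs_norm_ltP _ _).1 near_t.
  exists (Num.min d5 (x / C)); first by rewrite lt_min d50 divr_gt0.
  move=> s; rewrite lt_min => /andP[/h5 sd sx].
  have [sr Ks _] := PY _ sd.
  apply: le_lt_trans (lipY t s _ _ td sd Yr sr KY Ks) _.
  by rewrite distrC mulrC -ltr_pdivlMr.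
- by apply: filterS near_t => s /PY[].
Qed.

End Branch.

End Implicit.

(** * Invertibility of the regularized system for small rho *)

Section Rational.
Context {R : realType}.
Implicit Types a b : R -> R.

Definition rational_on_pos a := exists p q : {poly R},
  forall r : R, 0 < r -> q.[r] != 0 /\ a r = p.[r] / q.[r].

Lemma rat_poly (p : {poly R}) : rational_on_pos (fun r => p.[r]).
Proof. by exists p, 1 => r _; rewrite hornerC oner_eq0 divr1. Qed.

Lemma rat_cst (c : R) : rational_on_pos (fun=> c).
Proof.
have [p [q h]] := rat_poly c%:P; exists p, q => r /h[q0 E].
by rewrite -E hornerC.
Qed.

Lemma rat_id : rational_on_pos id.
Proof.
have [p [q h]] := rat_poly 'X; exists p, q => r /h[q0 E].
by rewrite -E hornerX.
Qed.

Lemma rat_add a b : rational_on_pos a -> rational_on_pos b ->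
  rational_on_pos (fun r => a r + b r).
Proof.
move=> [p [q h]] [p' [q' h']]; exists (p * q' + p' * q), (q * q') => r r0.
have [q0 ->] := h r r0; have [q0' ->] := h' r r0.
rewrite hornerD !hornerM mulf_neq0//; split=> //.
by field; rewrite q0 q0'.
Qed.

Lemma rat_mul a b : rational_on_pos a -> rational_on_pos b ->
  rational_on_pos (fun r => a r * b r).
Proof.
move=> [p [q h]] [p' [q' h']]; exists (p * p'), (q * q') => r r0.
have [q0 ->] := h r r0; have [q0' ->] := h' r r0.
rewrite !hornerM mulf_neq0//; split=> //.
by field; rewrite q0 q0'.
Qed.

Lemma rat_sum (I : Type) (s : seq I) (P : pred I) (a : I -> R -> R) :
  (forall i, rational_on_pos (a i)) ->
  rational_on_pos (fun r => \sum_(i <- s | P i) a i r).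
Proof.
move=> h; elim: s => [|i s ih].
  by under eq_fun do rewrite big_nil; exact: rat_cst.
under eq_fun do rewrite big_cons.
by case: (P i) => //; exact: rat_add.
Qed.

Lemma rat_prod (I : Type) (s : seq I) (P : pred I) (a : I -> R -> R) :
  (forall i, rational_on_pos (a i)) ->
  rational_on_pos (fun r => \prod_(i <- s | P i) a i r).
Proof.
move=> h; elim: s => [|i s ih].
  by under eq_fun do rewrite big_nil; exact: rat_cst.
under eq_fun do rewrite big_cons.
by case: (P i) => //; exact: rat_mul.
Qed.

Lemma rat_det n (M : R -> 'M[R]_n) :
  (forall i j, rational_on_pos (fun r => M r i j)) ->
  rational_on_pos (fun r => \det (M r)).
Proof.
move=> h; apply: rat_sum => s; apply: rat_mul; first exact: rat_cst.
by apply: rat_prod.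
Qed.

(** After division by the power of X that vanishes at 0, the quotient is
    nonzero at 0, hence near 0. *)
Lemma poly_near0_neq0 (p : {poly R}) : p != 0 ->
  \forall r \near (0 : R)^'+, p.[r] != 0.
Proof.
move=> p0; have [m [q /implyP/(_ p0) q0 ->]] := multiplicity_XsubC p 0.
have cq : \forall r \near (0 : R), q.[r] != 0.
  by apply: (@cvgr_neq0 R R^o _ _ _ _ _ (@continuous_horner R q 0)); rewrite -rootE.
near=> r; rewrite hornerM horner_exp hornerXsubC subr0 mulf_neq0//.
  near: r; apply: cvg_within; exact: cq.
rewrite expf_neq0// gt_eqF//; near: r; exact: nbhs_right_gt.
Unshelve. all: by end_near. Qed.

(** A rational function that does not vanish identically has no zero in some
    interval (0, d). *)
Lemma rational_near0_neq0 a (r1 : R) : rational_on_pos a -> 0 < r1 ->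
  a r1 != 0 -> \forall r \near (0 : R)^'+, a r != 0.
Proof.
move=> [p [q h]] r10 a1.
have p0 : p != 0.
  apply: contraNneq a1 => p0; have [_ ->] := h _ r10.
  by rewrite p0 horner0 mul0r.
near=> r; have r0 : 0 < r by near: r; exact: nbhs_right_gt.
have [q0 ->] := h r r0; rewrite mulf_neq0 ?invr_neq0//.
by near: r; exact: poly_near0_neq0.
Unshelve. all: by end_near. Qed.

End Rational.

Section Saddle.
Context {R : realType}.

Lemma sqr_colE n (u : 'cV[R]_n) : (u^T *m u) 0 0 = \sum_i u i 0 ^+ 2.
Proof. by rewrite mxE; apply: eq_bigr => i _; rewrite mxE expr2. Qed.

Lemma sqr_col_eq0 n (u : 'cV[R]_n) : (u^T *m u) 0 0 <= 0 -> u = 0.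
Proof.
rewrite sqr_colE => h; have := eq_le (\sum_i u i 0 ^+ 2) 0.
rewrite h sumr_ge0 => [|i _]; last exact: sqr_ge0.
move=> /= /eqP/psumr_eq0P E; apply/colP => i; rewrite mxE.
by apply/eqP; rewrite -sqrf_eq0; apply/eqP; apply: E => // j _; exact: sqr_ge0.
Qed.

Lemma sqr_col_ge0 n (u : 'cV[R]_n) : 0 <= (u^T *m u) 0 0.
Proof. by rewrite sqr_colE sumr_ge0// => i _; exact: sqr_ge0. Qed.

(** On the kernel, the second block row gives G u = rho w, and pairing the
    first one with u leaves u^T S u + rho |w|^2 = 0. *)
Lemma saddle_unitmx n m (S : 'M[R]_n) (G : 'M[R]_(m, n)) (rho : R) : 0 < rho ->
  (forall u : 'cV[R]_n, (u^T *m S *m u) 0 0 <= 0 -> u = 0) ->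
  block_mx S G^T G (- rho%:M) \in unitmx.
Proof.
move=> rho0 pos; set M := block_mx _ _ _ _.
suff inj (v : 'cV[R]_(n + m)) : M *m v = 0 -> v = 0.
  rewrite -unitmx_tr -row_free_unit; apply: inj_row_free => v vM.
  apply: trmx_inj; rewrite trmx0; apply: inj.
  by apply: trmx_inj; rewrite trmx_mul trmxK vM trmx0.
rewrite -[v]vsubmxK /M mul_block_col -[0]vsubmxK => /eq_col_mx[].
set u := usubmx v; set w := dsubmx v.
rewrite !linear0 mulNmx mul_scalar_mx => E1 /eqP; rewrite subr_eq0 => /eqP E2.
have E : (u^T *m S *m u) 0 0 + rho * (w^T *m w) 0 0 = 0.
  have := congr1 (fun A => u^T *m A) E1.
  rewrite mulmxDr !mulmxA -trmx_mul E2 mulmx0 linearZ /= -scalemxAl.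
  by move=> /(congr1 (fun A : 'M_1 => A 0 0)); rewrite mxE [X in _ + X]mxE [RHS]mxE.
have w0 := sqr_col_ge0 w.
have u0 : u = 0 by apply: pos; have := mulr_ge0 (ltW rho0) w0; lra.
have {}w0 : w = 0.
  by move: E2; rewrite u0 mulmx0 => /esym/eqP; rewrite scaler_eq0 gt_eqF//= => /eqP.
by rewrite u0 w0 col_mx0.
Qed.

Lemma sqr_norm_le n (u : 'cV[R]_n) : `|u| ^+ 2 <= (u^T *m u) 0 0.
Proof.
rewrite sqr_colE -(@ger0_norm _ (\sum_i _)) ?sumr_ge0// => [|i _]; last exact: sqr_ge0.
rewrite -ler_sqrt ?sqr_ge0// sqrtr_sqr normr_id.
apply: mx_norm_le => [|i j]; first exact: sqrtr_ge0.
rewrite -sqrtr_sqr ler_sqrt ?sumr_ge0// ?ord1.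
rewrite ger0_norm ?sumr_ge0// => [|k _]; last exact: sqr_ge0.
rewrite (bigD1 i)//= lerDl sumr_ge0// => k _; exact: sqr_ge0.
Qed.

(** This makes the quadratic form of L + rho positive definite for rho > c. *)
Lemma quadratic_form_bound n (L : 'M[R]_n) : exists2 c : R, 0 < c &
  forall u : 'cV[R]_n, - (c * (u^T *m u) 0 0) <= (u^T *m L *m u) 0 0.
Proof.
exists (n%:R * (n%:R * `|L|) + 1).
  by rewrite ltr_wpDl// mulr_ge0// mulr_ge0.
move=> u; have uu := sqr_norm_le u.
have tu : `|u^T| <= `|u| by apply: mx_norm_le => // i j; rewrite mxE le_coord_norm.
have h : `|(u^T *m L *m u) 0 0| <= n%:R * (n%:R * `|L|) * `|u| ^+ 2.
  apply: le_trans (le_coord_norm _ _ _) _; apply: le_trans (norm_mulmx_le _ _) _.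
  rewrite -mulrA ler_wpM2l// expr2 mulrA ler_wpM2r//.
  apply: le_trans (norm_mulmx_le _ _) _.
  by rewrite -mulrA ler_wpM2l// mulrC ler_wpM2l.
have h2 : n%:R * (n%:R * `|L|) * `|u| ^+ 2 <= n%:R * (n%:R * `|L|) * (u^T *m u) 0 0.
  by rewrite ler_wpM2l// mulr_ge0// mulr_ge0.
have := sqr_col_ge0 u.
move: h; rewrite ler_norml => /andP[h _]; move: h h2; lra.
Qed.

End Saddle.

Section System.
Context {R : realType} {nt nx nin neq : nat}.
Variables (f : 'rV[R]_nt -> 'rV[R]_nx -> R)
          (g : 'rV[R]_nt -> 'rV[R]_nx -> 'rV[R]_nin)
          (h : 'rV[R]_nt -> 'rV[R]_nx -> 'rV[R]_neq).
Variables (theta : 'rV[R]_nt)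
  (xib : 'rV[R]_nx * 'rV[R]_nin * 'rV[R]_(nin + neq)).

Let x := xib.1.1.
Let z := xib.1.2.
Let Ic := inactive g theta x.
Let GIc := Jac (fun y => subvec Ic (g theta y)) x.
Let G := col_mx (Jac (fun y => subvec (active g theta x) (g theta y)) x)
                (Jac (h theta) x).
Let L := Jac (grad (fun y => lagrangian f g h theta y (lsubmx xib.2) (rsubmx xib.2))) x.

Lemma system_blockE rho : Amat f g h theta xib + Bmat (neq := neq) g theta xib rho =
  block_mx (L + Hmat g theta xib rho + rho%:M) G^T G (- rho%:M).
Proof.
rewrite /Amat /Bmat add_block_mx tr_col_mx !addr0 add0r addrA.
congr block_mx; rewrite [in RHS]scalar_mx_block opp_block_mx.
by rewrite !oppr0.
Qed.

(** Hmat is a nonnegative combination of squares, so it does not spoil the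
    positivity of the upper left block. *)
Lemma Hmat_ge0 rho (u : 'cV[R]_nx) : 0 < rho ->
  0 <= (u^T *m Hmat g theta xib rho *m u) 0 0.
Proof.
move=> rho0; rewrite /Hmat -/x -/Ic -/GIc !mulmxA -trmx_mul -mulmxA.
rewrite mul_mx_diag mxE; apply: sumr_ge0 => k _; rewrite !mxE.
rewrite mulrAC; apply: mulr_ge0.
  by rewrite -expr2 sqr_ge0.
by rewrite divr_ge0 ?ltW// ltr_wpDl ?sqr_ge0// exprn_gt0.
Qed.

Lemma rational_system i j : rational_on_pos
  (fun rho => (Amat f g h theta xib + Bmat (neq := neq) g theta xib rho) i j).
Proof.
have rs n (k l : 'I_n) : rational_on_pos (fun rho : R => (rho%:M : 'M_n) k l).
  under eq_fun do rewrite mxE.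
  by case: (k == l); [exact: rat_id|exact: rat_cst].
have rN a : rational_on_pos a -> rational_on_pos (fun r : R => - a r).
  by move=> ra; under eq_fun do rewrite -mulN1r; exact: rat_mul (rat_cst _) ra.
under eq_fun do rewrite system_blockE.
case: (split_ordP i) => {}i ->; case: (split_ordP j) => {}j ->.
- under eq_fun do rewrite block_mxEul mxE [X in X + _]mxE.
  apply: rat_add (rs _ _ _); apply: rat_add; first exact: rat_cst.
  under eq_fun do rewrite mxE; apply: rat_sum => k.
  under eq_fun do rewrite mul_mx_diag !mxE.
  apply: rat_mul (rat_cst _); apply: rat_mul; first exact: rat_cst.
  exists 'X, ((z 0 (enum_val k) ^+ 2)%:P + 'X^2) => r r0.
  rewrite !hornerE; split=> //.
  by rewrite gt_eqF// ltr_wpDl ?sqr_ge0// exprn_gt0.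
- by under eq_fun do rewrite block_mxEur; exact: rat_cst.
- by under eq_fun do rewrite block_mxEdl; exact: rat_cst.
- under eq_fun do rewrite block_mxEdr mxE; apply: rN; exact: rs.
Qed.

(** Invertibility for one large rho, where the upper left block is positive
    definite, propagates to all small rho by rationality of the determinant. *)
Lemma system_unitmx : \forall rho \near (0 : R)^'+,
  Amat f g h theta xib + Bmat (neq := neq) g theta xib rho \in unitmx.
Proof.
have [c c0 hc] := quadratic_form_bound L.
have c10 : 0 < c + 1 by rewrite addr_gt0.
have ne : \det (Amat f g h theta xib + Bmat (neq := neq) g theta xib (c + 1)) != 0.
  rewrite -unitfE -/(_ \in unitmx) system_blockE.
  apply: saddle_unitmx => // u; rewrite !mulmxDr !mulmxDl mxE [X in X + _]mxE => hu.
  apply: sqr_col_eq0; have := Hmat_ge0 u c10; have := hc u.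
  move: hu; rewrite mul_mx_scalar -scalemxAl [X in _ + _ + X]mxE.
  by lra.
have := rational_near0_neq0 (rat_det rational_system) c10 ne.
by apply: filterS => rho; rewrite -unitfE.
Qed.

End System.

(** * Gradients and Jacobians *)

Section JacGrad.
Context {R : realType}.

Lemma strict_diff_ext (V W : normedModType R) (F : V -> W) p L M :
  strict_diff F p L -> L =1 M -> strict_diff F p M.
Proof. by move=> sF LM; have <- : L = M by apply/funext. Qed.

Lemma diff_Jac n m (F : 'rV[R]_n -> 'rV[R]_m) p v : differentiable F p ->
  'd F p v = v *m (Jac F p)^T.
Proof. by move=> dF; rewrite /Jac trmxK /jacobian mul_rV_lin1. Qed.

Lemma Jac_strict_diff n m (F : 'rV[R]_n -> 'rV[R]_m) p L v : strict_diff F p L ->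
  Jac F p *m v^T = (L v)^T.
Proof.
move=> /strict_diff_is_diff[dF dL].
by rewrite -dL diff_Jac// trmx_mul trmxK.
Qed.

Lemma grad_is_diff n (F : 'rV[R]_n -> R) p L : is_diff p F L ->
  grad F p = \row_j L (delta_mx 0 j).
Proof.
move=> [dF dL]; apply/rowP => j; rewrite !mxE deriveE; last exact: dF.
by rewrite dL.
Qed.

Lemma diff_grad n (F : 'rV[R]_n -> R) p v : differentiable F p ->
  'd F p v = (grad F p *m v^T) 0 0.
Proof.
move=> dF; rewrite (grad_is_diff (differentiableP dF)).
have b := diff_bounded_linear dF; have [l lE] := bl_linear b.
rewrite lE {1}(row_sum_delta v) linear_sum mxE; apply: eq_bigr => j _.
by rewrite linearZ !mxE /= mulrC.
Qed.

Lemma bl_dot n (w : 'rV[R]_n) : bounded_linear (fun u : 'rV[R]_n => (w *m u^T) 0 0).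
Proof.
apply: bl_mx => a u v.
by rewrite linearD linearZ /= mulmxDr -scalemxAr !mxE.
Qed.

Lemma is_diff_dot n m (w : 'rV[R]_m) (F : 'rV[R]_n -> 'rV[R]_m) p :
  differentiable F p ->
  is_diff p (fun x => (w *m (F x)^T) 0 0) (fun v => (w *m Jac F p *m v^T) 0 0).
Proof.
move=> dF.
have [d1 d2] := strict_diff_is_diff (strict_diff_lin (F p) (bl_dot w)).
have i1 : is_diff (F p) (fun u => (w *m u^T) 0 0) (fun u => (w *m u^T) 0 0).
  by apply: DiffDef; [exact: d1|exact: d2].
have [e1 e2] := is_diff_comp (differentiableP dF) i1.
apply: DiffDef; first exact: e1.
have {}e2 : 'd (fun x => (w *m (F x)^T) 0 0) p =
    (fun u => (w *m u^T) 0 0) \o 'd F p :> (_ -> _) by exact: e2.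
by rewrite e2; apply/funext => v /=; rewrite diff_Jac// trmx_mul trmxK mulmxA.
Qed.

Lemma grad_coord n m (F : 'rV[R]_n -> 'rV[R]_m) p i : differentiable F p ->
  grad (fun x => F x 0 i) p = row i (Jac F p).
Proof.
move=> dF; have := is_diff_dot (delta_mx 0 i) dF.
have -> : (fun x => ((delta_mx 0 i : 'rV_m) *m (F x)^T) 0 0)  = (fun x => F x 0 i).
  by apply/funext => x; rewrite -rowE !mxE.
move=> /grad_is_diff ->; apply/rowP => j.
by rewrite mxE -rowE trmx_delta -colE !mxE.
Qed.

Lemma bl_row_mx a b : bounded_linear (fun p : 'rV[R]_a * 'rV[R]_b => row_mx p.1 p.2).
Proof.
split.
  by move=> c u v; rewrite scale_row_mx add_row_mx.
exists 1 => v; rewrite mul1r; apply: mx_norm_le => // i j.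
case: (split_ordP j) => {}j ->; rewrite ?row_mxEl ?row_mxEr.
  by apply: le_trans (le_coord_norm _ _ _) _; rewrite prod_normE le_max lexx.
by apply: le_trans (le_coord_norm _ _ _) _; rewrite prod_normE le_max lexx orbT.
Qed.

Lemma strict_diff_row_mx (V : normedModType R) a b (F : V -> 'rV[R]_a) (G : V -> 'rV[R]_b) p L M :
  strict_diff F p L -> strict_diff G p M ->
  strict_diff (fun v => row_mx (F v) (G v)) p (fun v => row_mx (L v) (M v)).
Proof.
move=> sF sG.
exact: (strict_diff_comp (strict_diff_pair sF sG) (strict_diff_lin _ (bl_row_mx a b))).
Qed.

Lemma bl_lsubmx a b : bounded_linear (fun u : 'rV[R]_(a + b) => lsubmx u).
Proof. by apply: bl_mx => c u v; rewrite linearP. Qed.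
Lemma bl_rsubmx a b : bounded_linear (fun u : 'rV[R]_(a + b) => rsubmx u).
Proof. by apply: bl_mx => c u v; rewrite linearP. Qed.
Lemma bl_diag a : bounded_linear (fun u : 'rV[R]_a => diag_mx u).
Proof. by apply: bl_mx => c u v; rewrite linearP. Qed.
Lemma bl_subvec a (I : {set 'I_a}) : bounded_linear (@subvec R a I).
Proof. by apply: bl_mx => c u v; apply/rowP => j; rewrite !mxE. Qed.

Lemma strict_diff_scale (V W : normedModType R) c (F : V -> W) p L :
  strict_diff F p L -> strict_diff (fun v => c *: F v) p (fun v => c *: L v).
Proof.
move=> sF; exact: (strict_diff_comp sF (strict_diff_lin _ (bl_scale c (bl_id _)))).
Qed.

Lemma strict_diff_shift (V W : normedModType R) c (F : V -> W) p L :
  strict_diff F p L -> strict_diff (fun v => F v + c) p L.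
Proof.
move=> sF; apply: (strict_diff_ext (strict_diff_add sF (strict_diff_cst c p))).
by move=> v; rewrite addr0.
Qed.

Lemma is_diff_sqnorm (V : normedModType R) n (F : V -> 'rV[R]_n) p L :
  strict_diff F p L ->
  is_diff p (fun v => sqnorm (F v)) (fun v => 2 * (F p *m (L v)^T) 0 0).
Proof.
move=> sF; have bT : bounded_linear (fun u : 'rV[R]_n => u^T).
  by apply: bl_mx => c u v; rewrite linearP.
have sT := strict_diff_comp sF (strict_diff_lin _ bT).
have bE : bounded_linear (fun u : 'M[R]_1 => u 0 0).
  by apply: bl_mx => c u v; rewrite !mxE.
have s := strict_diff_comp (strict_diff_mulmx sF sT) (strict_diff_lin _ bE).
have [d1 d2] := strict_diff_is_diff s.
have -> : (fun v => sqnorm (F v)) = (fun v => (F v *m (F v)^T) 0 0).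
  apply/funext => v; rewrite /sqnorm mxE; apply: eq_bigr => j _.
  by rewrite mxE expr2.
apply: DiffDef; first exact: d1.
rewrite d2; apply/funext => v; rewrite mxE.
have -> : (L v *m (F p)^T) 0 0 = (F p *m (L v)^T) 0 0.
  by rewrite !mxE; apply: eq_bigr => j _; rewrite !mxE mulrC.
by rewrite -mulr2n mulr_natl.
Qed.

End JacGrad.

(** * The regularized problem as an unconstrained one *)

Definition dotp (R : realType) n (u v : 'rV[R]_n) : R := (u *m v^T) 0 0.

Section Dot.
Context {R : realType}.
Lemma dotpDl n (u v w : 'rV[R]_n) : dotp (u + v) w = dotp u w + dotp v w.
Proof. by rewrite /dotp mulmxDl mxE. Qed.
Lemma dotpDr n (u v w : 'rV[R]_n) : dotp w (u + v) = dotp w u + dotp w v.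
Proof. by rewrite /dotp linearD mulmxDr mxE. Qed.
Lemma dotpZl n a (u w : 'rV[R]_n) : dotp (a *: u) w = a * dotp u w.
Proof. by rewrite /dotp -scalemxAl mxE. Qed.
Lemma dotpZr n a (u w : 'rV[R]_n) : dotp w (a *: u) = a * dotp w u.
Proof. by rewrite /dotp linearZ -scalemxAr mxE. Qed.
Lemma dotp_row_mx n m (a : 'rV[R]_n) (b : 'rV[R]_m) v :
  dotp (row_mx a b) v = dotp a (lsubmx v) + dotp b (rsubmx v).
Proof. by rewrite /dotp -{1}(hsubmxK v) tr_row_mx mul_row_col mxE. Qed.
Lemma dotp_row_mxr n m (a : 'rV[R]_n) (b : 'rV[R]_m) u :
  dotp u (row_mx a b) = dotp (lsubmx u) a + dotp (rsubmx u) b.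
Proof. by rewrite -{1}(hsubmxK u) dotp_row_mx row_mxKl row_mxKr. Qed.
Lemma dotp_mulmx n m (u : 'rV[R]_n) (A : 'M[R]_(m, n)) (v : 'rV[R]_m) :
  dotp u (v *m A) = dotp (u *m A^T) v.
Proof. by rewrite /dotp trmx_mul mulmxA. Qed.
Lemma mul_diagC n (u v : 'rV[R]_n) : u *m diag_mx v = v *m diag_mx u.
Proof. by apply/rowP => j; rewrite !mul_mx_diag !mxE mulrC. Qed.
Lemma half_mul_diag n (u v : 'rV[R]_n) :
  2^-1 *: (u *m diag_mx v + v *m diag_mx u) = u *m diag_mx v.
Proof.
apply/rowP => j; rewrite (mul_diagC v) mxE [X in _ * X]mxE.
by move: (fun_of_matrix _ _ _) => x; field.
Qed.
End Dot.

Section Regularized.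
Context {R : realType} {nt nx nin neq : nat}.
Variables (f : 'rV[R]_nt -> 'rV[R]_nx -> R)
          (g : 'rV[R]_nt -> 'rV[R]_nx -> 'rV[R]_nin)
          (h : 'rV[R]_nt -> 'rV[R]_nx -> 'rV[R]_neq).
Hypothesis smooth : smooth_data f g h.
Variable xib : 'rV[R]_nx * 'rV[R]_nin * 'rV[R]_(nin + neq).
Variable rho : R.
Hypothesis rho0 : 0 < rho.

Let xb := xib.1.1.
Let zb := xib.1.2.
Let mub := xib.2.

(** The value of mu that the equality constraint forces at (x, z) = y. *)
Definition reduced_mu (t : 'rV[R]_nt) (y : 'rV[R]_(nx + nin)) : 'rV[R]_(nin + neq) :=
  mub + rho^-1 *: slack_con g h t (lsubmx y) (rsubmx y).

Definition reduced_obj (t : 'rV[R]_nt) (y : 'rV[R]_(nx + nin)) : R :=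
  f t (lsubmx y) + rho / 2 * (sqnorm (lsubmx y - xb) + sqnorm (rsubmx y - zb)
                              + sqnorm (reduced_mu t y)).

Definition residual (q : 'rV[R]_nt * 'rV[R]_(nx + nin)) : 'rV[R]_(nx + nin) :=
  let t := q.1 in let x := lsubmx q.2 in let z := rsubmx q.2 in
  let mu := reduced_mu t q.2 in
  row_mx (grad (f t) x + rho *: (x - xb)
            + lsubmx mu *m Jac (g t) x + rsubmx mu *m Jac (h t) x)
         (z *m diag_mx (lsubmx mu) + rho *: (z - zb)).

Local Notation Dgrad := (fun q => 'd (fun q : 'rV[R]_nt * 'rV[R]_nx => grad (f q.1) q.2) q).
Local Notation Dg := (fun q => 'd (fun q : 'rV[R]_nt * 'rV[R]_nx => g q.1 q.2) q).
Local Notation Dh := (fun q => 'd (fun q : 'rV[R]_nt * 'rV[R]_nx => h q.1 q.2) q).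
Local Notation DJg := (fun q => 'd (fun q : 'rV[R]_nt * 'rV[R]_nx => Jac (g q.1) q.2) q).
Local Notation DJh := (fun q => 'd (fun q : 'rV[R]_nt * 'rV[R]_nx => Jac (h q.1) q.2) q).

(** Derivative of [reduced_mu] jointly in the parameter and y; the slack term
    z^2 / 2 contributes z dz. *)
Definition dmu (p v : 'rV[R]_nt * 'rV[R]_(nx + nin)) : 'rV[R]_(nin + neq) :=
  let q := (p.1, lsubmx p.2) in let w := (v.1, lsubmx v.2) in
  rho^-1 *: row_mx (Dg q w + rsubmx v.2 *m diag_mx (rsubmx p.2)) (Dh q w).

Definition dresidual (p v : 'rV[R]_nt * 'rV[R]_(nx + nin)) : 'rV[R]_(nx + nin) :=
  let q := (p.1, lsubmx p.2) in let w := (v.1, lsubmx v.2) in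
  let mu := reduced_mu p.1 p.2 in
  row_mx (Dgrad q w + rho *: lsubmx v.2
            + (lsubmx (dmu p v) *m Jac (g p.1) (lsubmx p.2) + lsubmx mu *m DJg q w)
            + (rsubmx (dmu p v) *m Jac (h p.1) (lsubmx p.2) + rsubmx mu *m DJh q w))
         (rsubmx v.2 *m diag_mx (lsubmx mu) + rsubmx p.2 *m diag_mx (lsubmx (dmu p v))
            + rho *: rsubmx v.2).

Lemma strict_diff_tx (p : 'rV[R]_nt * 'rV[R]_(nx + nin)) :
  strict_diff (fun q : 'rV[R]_nt * 'rV[R]_(nx + nin) => (q.1, lsubmx q.2)) p
    (fun v => (v.1, lsubmx v.2)).
Proof.
apply: strict_diff_lin.
exact: (bl_pair (bl_fst _ _) (bl_comp (bl_lsubmx _ _) (bl_snd _ _))).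
Qed.

Lemma strict_diff_z (p : 'rV[R]_nt * 'rV[R]_(nx + nin)) :
  strict_diff (fun q : 'rV[R]_nt * 'rV[R]_(nx + nin) => rsubmx q.2) p
    (fun v => rsubmx v.2).
Proof.
apply: strict_diff_lin; exact: (bl_comp (bl_rsubmx _ _) (bl_snd _ _)).
Qed.

Lemma strict_diff_mu p : strict_diff (fun q => reduced_mu q.1 q.2) p (dmu p).
Proof.
have sg := strict_diff_comp (strict_diff_tx p)
  (C1_at_strict_diff (g_C1 smooth (p.1, lsubmx p.2))).
have sh := strict_diff_comp (strict_diff_tx p)
  (C1_at_strict_diff (h_C1 smooth (p.1, lsubmx p.2))).
have sz := strict_diff_z p.
have sd := strict_diff_comp sz (strict_diff_lin (rsubmx p.2) (bl_diag nin)).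
have sq := strict_diff_scale (2^-1) (strict_diff_mulmx sz sd).
have s := strict_diff_shift mub (strict_diff_scale (rho^-1)
  (strict_diff_row_mx (strict_diff_add sg sq) sh)).
have -> : (fun q : 'rV[R]_nt * 'rV[R]_(nx + nin) => reduced_mu q.1 q.2) =
  (fun q => rho^-1 *: row_mx
    (g q.1 (lsubmx q.2) + 2^-1 *: (rsubmx q.2 *m diag_mx (rsubmx q.2)))
    (h q.1 (lsubmx q.2)) + mub).
  apply/funext => q; rewrite /reduced_mu /slack_con addrC.
  have -> // : \row_i (rsubmx q.2 0 i ^+ 2 / 2) =
      2^-1 *: (rsubmx q.2 *m diag_mx (rsubmx q.2)).
  move: (rsubmx q.2) => z; apply/rowP => j.
  by rewrite mxE [RHS]mxE mul_mx_diag mxE expr2 mulrC.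
apply: (strict_diff_ext s) => v; rewrite /dmu; congr (_ *: row_mx (_ + _) _).
exact: half_mul_diag.
Qed.

Lemma strict_diff_residual p : strict_diff residual p (dresidual p).
Proof.
have sx := strict_diff_tx p.
have sgr := strict_diff_comp sx
  (C1_at_strict_diff (grad_f_C1 smooth (p.1, lsubmx p.2))).
have sJg := strict_diff_comp sx
  (C1_at_strict_diff (Jac_g_C1 smooth (p.1, lsubmx p.2))).
have sJh := strict_diff_comp sx
  (C1_at_strict_diff (Jac_h_C1 smooth (p.1, lsubmx p.2))).
have sz := strict_diff_z p.
have sm := strict_diff_mu p.
have sl := strict_diff_comp sm (strict_diff_lin _ (bl_lsubmx nin neq)).
have sn := strict_diff_comp sm (strict_diff_lin _ (bl_rsubmx nin neq)).
have sd := strict_diff_comp sl (strict_diff_lin _ (bl_diag nin)).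
have sx2 := strict_diff_comp sx (strict_diff_lin _ (bl_snd _ _)).
have srx := strict_diff_scale rho (strict_diff_shift (- xb) sx2).
have srz := strict_diff_scale rho (strict_diff_shift (- zb) sz).
exact: (strict_diff_row_mx
  (strict_diff_add (strict_diff_add (strict_diff_add sgr srx) (strict_diff_mulmx sl sJg))
     (strict_diff_mulmx sn sJh))
  (strict_diff_add (strict_diff_mulmx sz sd) srz)).
Qed.

Lemma strict_diff_x (W : normedModType R) (t : 'rV[R]_nt) (x : 'rV[R]_nx)
    (F : 'rV[R]_nt * 'rV[R]_nx -> W) L :
  strict_diff F (t, x) L -> strict_diff (fun y => F (t, y)) x (fun v => L (0, v)).
Proof.
move=> sF; apply: (strict_diff_comp (F := fun y => (t, y)) _ sF).
exact: (strict_diff_pair (strict_diff_cst t x) (strict_diff_lin x (bl_id _))).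
Qed.

Lemma strict_diff_t (W : normedModType R) (t : 'rV[R]_nt) (x : 'rV[R]_nx)
    (F : 'rV[R]_nt * 'rV[R]_nx -> W) L :
  strict_diff F (t, x) L -> strict_diff (fun s => F (s, x)) t (fun v => L (v, 0)).
Proof.
move=> sF; apply: (strict_diff_comp (F := fun s => (s, x)) _ sF).
exact: (strict_diff_pair (strict_diff_lin t (bl_id _)) (strict_diff_cst x t)).
Qed.

Lemma differentiable_f t x : differentiable (f t) x.
Proof. exact: (nbhs_singleton (f_C2 smooth t x).1.1). Qed.
Lemma differentiable_g t x : differentiable (g t) x.
Proof. exact: (nbhs_singleton (g_C2 smooth t x).1.1). Qed.
Lemma differentiable_h t x : differentiable (h t) x.
Proof. exact: (nbhs_singleton (h_C2 smooth t x).1.1). Qed.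

(** The slacks enter the constraints additively, so that they drop out of
    the x-gradients. *)
Lemma sum_grad_slack t x (psi : 'rV[R]_(nin + neq)) :
  \sum_i psi 0 i *: grad (fun y => slack_con g h t y 0 0 i) x =
  lsubmx psi *m Jac (g t) x + rsubmx psi *m Jac (h t) x.
Proof.
rewrite big_split_ord !mulmx_sum_row; congr (_ + _); apply: eq_bigr => i _.
  have -> : (fun y => slack_con g h t y 0 0 (lshift neq i)) = (fun y => g t y 0 i).
    by apply/funext => y; rewrite row_mxEl !mxE expr0n mul0r addr0.
  by rewrite (grad_coord i (differentiable_g t x)) [lsubmx psi 0 i]mxE.
have -> : (fun y => slack_con g h t y 0 0 (rshift nin i)) = (fun y => h t y 0 i).
  by apply/funext => y; rewrite row_mxEr.
by rewrite (grad_coord i (differentiable_h t x)) [rsubmx psi 0 i]mxE.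
Qed.

Lemma grad_lagrangian t x lam nu :
  grad (fun y => lagrangian f g h t y lam nu) x =
  grad (f t) x + lam *m Jac (g t) x + nu *m Jac (h t) x.
Proof.
have -> : (fun y => lagrangian f g h t y lam nu) =
    (fun y => f t y + (lam *m (g t y)^T) 0 0 + (nu *m (h t y)^T) 0 0).
  apply/funext => y; rewrite /lagrangian !mxE; congr (_ + _ + _);
    by apply: eq_bigr => i _; rewrite !mxE.
have i1 := differentiableP (differentiable_f t x).
have i2 := is_diff_dot lam (differentiable_g t x).
have i3 := is_diff_dot nu (differentiable_h t x).
rewrite (grad_is_diff (is_diffD (is_diffD i1 i2) i3)).
apply/rowP => j; rewrite mxE [RHS]mxE [X in _ = X + _]mxE.
rewrite -[LHS]/('d (f t) x (delta_mx 0 j) + (lam *m Jac (g t) x *m (delta_mx 0 j)^T) 0 0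
  + (nu *m Jac (h t) x *m (delta_mx 0 j)^T) 0 0).
by rewrite diff_grad ?trmx_delta -?colE ?mxE//; exact: differentiable_f.
Qed.

(** The last two equations identify psi and mu with [reduced_mu]; the first
    two are then the two blocks of [residual]. *)
Lemma P3_kktE t x (z : 'rV[R]_nin) (mu psi : 'rV[R]_(nin + neq)) :
  [/\ grad (f t) x + rho *: (x - xb)
        + \sum_i psi 0 i *: grad (fun y => slack_con g h t y 0 0 i) x = 0,
      z *m diag_mx (lsubmx psi) + rho *: (z - zb) = 0,
      rho *: (mu - psi) = 0
    & slack_con g h t x z + rho *: (mub - mu) = 0] <->
  [/\ psi = mu, mu = reduced_mu t (row_mx x z) & residual (t, row_mx x z) = 0].
Proof.
have rn0 : rho != 0 by rewrite gt_eqF.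
rewrite /residual /= !row_mxKl !row_mxKr sum_grad_slack addrA.
have E : slack_con g h t x z + rho *: (mub - mu) = 0 <->
    mu = reduced_mu t (row_mx x z).
  rewrite /reduced_mu row_mxKl row_mxKr; split=> [/eqP|->].
    rewrite addr_eq0 -scalerN opprB => /eqP ->.
    by rewrite scalerA mulVf// scale1r addrC subrK.
  by rewrite opprD addrA subrr sub0r scalerN scalerA mulfV// scale1r subrr.
split=> [[e1 e2 /eqP e3 e4]|[-> e2 e3]].
  move: e3; rewrite scaler_eq0 (negbTE rn0) subr_eq0 /= => /eqP pm.
  by move/E: e4 => mE; rewrite -mE pm e1 e2 row_mx0.
move: (e3); rewrite -row_mx0 => /eq_row_mx[]; rewrite -e2 => k1 k2.
by split=> //; [rewrite subrr scaler0|exact/E].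
Qed.

(** The penalty rho / 2 |mu|^2 contributes rho <mu, dmu>, and the factor
    1 / rho in dmu turns this into the multiplier terms of the residual. *)
Lemma diff_reduced_obj t y : differentiable (reduced_obj t) y /\
  forall v, 'd (reduced_obj t) y v = (residual (t, y) *m v^T) 0 0.
Proof.
have sx := strict_diff_lin y (bl_lsubmx (R := R) nx nin).
have sz := strict_diff_lin y (bl_rsubmx (R := R) nx nin).
have [dx1 dx2] := strict_diff_is_diff sx.
have ix : is_diff y (fun y : 'rV[R]_(nx + nin) => lsubmx y) (fun y => lsubmx y).
  by apply: DiffDef; [exact: dx1|exact: dx2].
have i1 := is_diff_comp ix (differentiableP (differentiable_f t (lsubmx y))).
have i2 := is_diff_sqnorm (strict_diff_shift (- xb) sx).
have i3 := is_diff_sqnorm (strict_diff_shift (- zb) sz).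
have sy : strict_diff (fun y' => (t, y')) y (fun v : 'rV[R]_(nx + nin) => (0, v)).
  exact: (strict_diff_pair (strict_diff_cst t y) (strict_diff_lin y (bl_id _))).
have i4 := is_diff_sqnorm (strict_diff_comp sy (strict_diff_mu (t, y))).
have [e1 e2] := is_diffD i1 (is_diffZ (rho / 2) (is_diffD (is_diffD i2 i3) i4)).
split; first exact: e1.
move=> v.
have {}e2 : 'd (reduced_obj t) y v = 'd (f t) (lsubmx y) (lsubmx v) + rho / 2 *
   (2 * dotp (lsubmx y - xb) (lsubmx v) + 2 * dotp (rsubmx y - zb) (rsubmx v)
    + 2 * dotp (reduced_mu t y) (dmu (t, y) (0, v))).
  exact: (congr1 (fun F => F v) e2).
rewrite e2 diff_grad; last exact: differentiable_f.
rewrite -/(dotp _ _) -/(dotp _ _) /residual /=.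
move: (reduced_mu t y) => mu.
rewrite dotp_row_mx !(dotpDl, dotpZl).
have rn0 : rho != 0 by rewrite gt_eqF.
rewrite /dmu /= dotpZr dotp_row_mxr dotpDr.
have -> : Dg (t, lsubmx y) (0, lsubmx v) = lsubmx v *m (Jac (g t) (lsubmx y))^T.
  rewrite -diff_Jac; last exact: differentiable_g.
  have s := strict_diff_x (C1_at_strict_diff (g_C1 smooth (t, lsubmx y))).
  by have [_ ->] := strict_diff_is_diff s.
have -> : Dh (t, lsubmx y) (0, lsubmx v) = lsubmx v *m (Jac (h t) (lsubmx y))^T.
  rewrite -diff_Jac; last exact: differentiable_h.
  have s := strict_diff_x (C1_at_strict_diff (h_C1 smooth (t, lsubmx y))).
  by have [_ ->] := strict_diff_is_diff s.
rewrite !dotp_mulmx !(trmxK (Jac _ _)) tr_diag_mx (mul_diagC (rsubmx y)).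
by field.
Qed.

(** Feasible points are the graph of [reduced_mu], over which the objective
    is [reduced_obj]; y' |-> (y', mu) is continuous with continuous left
    inverse, so neighbourhoods correspond. *)
Lemma P3_min_reduced t y :
  local_minimizer (P3_feasible g h xib rho t) (P3_obj f xib rho t)
     (lsubmx y, rsubmx y, reduced_mu t y) <->
  \forall y' \near y, reduced_obj t y <= reduced_obj t y'.
Proof.
have rn0 : rho != 0 by rewrite gt_eqF.
have feas x z mu : P3_feasible g h xib rho t (x, z, mu) <->
    mu = reduced_mu t (row_mx x z).
  rewrite /P3_feasible /reduced_mu /= row_mxKl row_mxKr; split=> [/eqP|->].
    rewrite addr_eq0 -scalerN opprB => /eqP ->.
    by rewrite scalerA mulVf// scale1r addrC subrK.
  by rewrite opprD addrA subrr sub0r scalerN scalerA mulfV// scale1r subrr.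
split.
  move=> [_ hmin].
  pose m (y' : 'rV[R]_(nx + nin)) := (lsubmx y', rsubmx y', reduced_mu t y').
  have sx := strict_diff_lin y (bl_lsubmx (R := R) nx nin).
  have sz := strict_diff_lin y (bl_rsubmx (R := R) nx nin).
  have sy : strict_diff (fun y' => (t, y')) y (fun v : 'rV[R]_(nx + nin) => (0, v)).
    exact: (strict_diff_pair (strict_diff_cst t y) (strict_diff_lin y (bl_id _))).
  have cm : {for y, continuous m}.
    exact: (strict_diff_continuous (strict_diff_pair (strict_diff_pair sx sz)
       (strict_diff_comp sy (strict_diff_mu (t, y))))).
  have H : \forall y' \near y, P3_feasible g h xib rho t (m y') ->
      P3_obj f xib rho t (m y) <= P3_obj f xib rho t (m y') by exact: (cm _ hmin).
  apply: filterS H => y' /= H.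
  by apply: H; apply/feas; rewrite hsubmxK.
move=> hmin; split; first by apply/feas; rewrite hsubmxK.
pose r (xi : 'rV[R]_nx * 'rV[R]_nin * 'rV[R]_(nin + neq)) := row_mx xi.1.1 xi.1.2.
pose xi := (lsubmx y, rsubmx y, reduced_mu t y).
have cr : {for xi, continuous r}.
  apply: bl_continuous.
  exact: (bl_comp (bl_row_mx nx nin) (bl_fst _ _)).
have hmin' : \forall y' \near r xi, reduced_obj t y <= reduced_obj t y'.
  by rewrite /r /xi /= hsubmxK.
have H : \forall xi' \near xi, reduced_obj t y <= reduced_obj t (r xi').
  exact: (cr _ hmin').
apply: filterS H => -[[x z] mu] /= H /feas ->.
by move: H; rewrite /reduced_obj /r /= row_mxKl row_mxKr.
Qed.

End Regularized.

(** * From the linearized residual to the linear system *)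

Section Selection.
Context {R : realType}.

Lemma Jac_subvec n m (I : {set 'I_m}) (F : 'rV[R]_n -> 'rV[R]_m) p L v :
  strict_diff F p L ->
  Jac (fun y => subvec I (F y)) p *m v^T = (subvec I (L v))^T.
Proof.
move=> sF; have s := strict_diff_comp sF (strict_diff_lin _ (bl_subvec I)).
by rewrite (Jac_strict_diff _ s).
Qed.

Lemma Jac_subvecE n m (I : {set 'I_m}) (F : 'rV[R]_n -> 'rV[R]_m) p L :
  strict_diff F p L ->
  Jac (fun y => subvec I (F y)) p = rowsub enum_val (Jac F p).
Proof.
move=> sF; apply/matrixP => i j.
have e := Jac_subvec I (delta_mx 0 j) sF.
have e' := Jac_strict_diff (delta_mx 0 j) sF.
rewrite trmx_delta -colE in e; rewrite trmx_delta -colE in e'.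
move/matrixP/(_ i 0): e; rewrite [LHS]mxE [RHS]mxE [RHS]mxE => ->.
by move/matrixP/(_ (enum_val i) 0): e'; rewrite [LHS]mxE [RHS]mxE [RHS in _ -> _ = RHS]mxE => ->.
Qed.

Lemma mulmx_split n m (I : {set 'I_m}) (u : 'rV[R]_m) (A : 'M[R]_(m, n)) :
  u *m A = subvec I u *m rowsub enum_val A
         + subvec (~: I)%SET u *m rowsub enum_val A.
Proof.
apply/rowP => j; rewrite !mxE (bigID (mem I)) /=; congr (_ + _).
  by rewrite big_enum_val; apply: eq_bigr => k _; rewrite !mxE.
rewrite (eq_bigl (mem (~: I)%SET)) => [|k]; last by rewrite !inE.
by rewrite big_enum_val; apply: eq_bigr => k _; rewrite !mxE.
Qed.

(** For lam = 0 the slack equation gives dz = - z dlam / rho, and substitution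
    into rho dlam = G + z dz produces the weight rho / (z^2 + rho^2). *)
Lemma slack_elimination n (lam dlam z dz G : 'rV[R]_n) (rho : R) i : 0 < rho ->
  lam 0 i = 0 -> rho *: dlam = G + dz *m diag_mx z ->
  dz *m diag_mx lam + z *m diag_mx dlam + rho *: dz = 0 ->
  dlam 0 i = G 0 i * (rho / (z 0 i ^+ 2 + rho ^+ 2)).
Proof.
move=> rho0 l0 /rowP/(_ i); rewrite mul_mx_diag !mxE => E1.
move=> /rowP/(_ i); rewrite !mul_mx_diag !mxE l0 mulr0 add0r.
move: (dlam 0 i) (dz 0 i) (z 0 i) (G 0 i) E1 => l s y G' E1 E2.
have n0 : y ^+ 2 + rho ^+ 2 != 0 by rewrite gt_eqF// ltr_wpDl ?sqr_ge0// exprn_gt0.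
have rn0 : rho != 0 by rewrite gt_eqF.
have -> : G' = rho * l - s * y by rewrite E1 addrK.
have -> : s = - (y * l) / rho.
  apply: (mulfI rn0); rewrite mulrCA mulfV// mulr1.
  by apply/eqP; rewrite -addr_eq0 addrC E2.
by field; rewrite rn0 n0.
Qed.

End Selection.

(** Bookkeeping for the first block row of the system: q stands for the
    inactive multiplier term, of which t is the part due to the parameter. *)
Lemma rearrange_first_block (R : realType) n (a b c a' b' c' r p q s t : 'cV[R]_n) :
  a + b + c + (a' + b' + c') + r + (p + q) + s = 0 ->
  a + b + c + (q - t) + r + (p + s) = - a' - b' - c' - t.
Proof.
by move=> /colP E; apply/colP => k; move: (E k); rewrite !mxE; lra.
Qed.

Section Link.
Context {R : realType} {nt nx nin neq : nat}.
Variables (f : 'rV[R]_nt -> 'rV[R]_nx -> R)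
          (g : 'rV[R]_nt -> 'rV[R]_nx -> 'rV[R]_nin)
          (h : 'rV[R]_nt -> 'rV[R]_nx -> 'rV[R]_neq).
Hypothesis smooth : smooth_data f g h.
Variable theta : 'rV[R]_nt.
Variable xib : 'rV[R]_nx * 'rV[R]_nin * 'rV[R]_(nin + neq).
Hypothesis xib_Xi : Xi f g h theta xib.
Variable rho : R.
Hypothesis rho0 : 0 < rho.

Let xb := xib.1.1.
Let zb := xib.1.2.
Let mub := xib.2.
Let lam := lsubmx mub.
Let nu := rsubmx mub.
Let y0 := row_mx xb zb.
Let I := active g theta xb.
Let Ic := inactive g theta xb.

Lemma Xi_facts : [/\ forall i, g theta xb 0 i <= 0, h theta xb = 0,
  forall i, lam 0 i * g theta xb 0 i = 0, forall i, 0 <= lam 0 i &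
  forall i, zb 0 i = Num.sqrt (- (2 * g theta xb 0 i))].
Proof.
rewrite /lam /mub /zb /xb; move: xib_Xi; case: xib => [[x z] mu] /=.
by move=> [[_ _ [? ?] ? ?] ?].
Qed.

(** z^2 / 2 = - g by the choice of the slacks. *)
Lemma slack_con0 : slack_con g h theta xb zb = 0.
Proof.
have [gle hE _ _ zE] := Xi_facts; rewrite /slack_con hE.
have -> : g theta xb + \row_i (zb 0 i ^+ 2 / 2) = 0; last exact: row_mx0.
apply/rowP => i; rewrite !mxE zE sqr_sqrtr.
  by field.
by rewrite oppr_ge0 pmulr_rle0.
Qed.

Lemma reduced_mu0 : reduced_mu g h xib rho theta y0 = mub.
Proof. by rewrite /reduced_mu /y0 row_mxKl row_mxKr slack_con0 scaler0 addr0. Qed.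

Lemma active_slack0 i : i \in I -> zb 0 i = 0.
Proof.
have [_ _ _ _ zE] := Xi_facts; rewrite inE => /eqP gi.
by rewrite zE gi mulr0 oppr0 sqrtr0.
Qed.

Lemma inactive_mult0 i : i \in Ic -> lam 0 i = 0.
Proof.
have [_ _ cE _ _] := Xi_facts; rewrite !inE => gi.
by have /eqP := cE i; rewrite mulf_eq0 (negbTE gi) orbF => /eqP.
Qed.

Local Notation D := (dresidual f g h xib rho (theta, y0)).
Local Notation M := (dmu g h rho (theta, y0)).
Local Notation Dgrad := ('d (fun q : 'rV[R]_nt * 'rV[R]_nx => grad (f q.1) q.2) (theta, xb)).
Local Notation Dg := ('d (fun q : 'rV[R]_nt * 'rV[R]_nx => g q.1 q.2) (theta, xb)).
Local Notation Dh := ('d (fun q : 'rV[R]_nt * 'rV[R]_nx => h q.1 q.2) (theta, xb)).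
Local Notation DJg := ('d (fun q : 'rV[R]_nt * 'rV[R]_nx => Jac (g q.1) q.2) (theta, xb)).
Local Notation DJh := ('d (fun q : 'rV[R]_nt * 'rV[R]_nx => Jac (h q.1) q.2) (theta, xb)).

(** Derivative in (t, x) of the x-gradient of the Lagrangian, for multipliers
    fixed at their base values. *)
Definition dlagr (w : 'rV[R]_nt * 'rV[R]_nx) : 'rV[R]_nx :=
  Dgrad w + lam *m DJg w + nu *m DJh w.

Lemma strict_diff_dlagr : strict_diff
  (fun q : 'rV[R]_nt * 'rV[R]_nx => grad (fun y => lagrangian f g h q.1 y lam nu) q.2)
  (theta, xb) dlagr.
Proof.
have -> : (fun q : 'rV[R]_nt * 'rV[R]_nx => grad (fun y => lagrangian f g h q.1 y lam nu) q.2)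
  = (fun q => grad (f q.1) q.2 + lam *m Jac (g q.1) q.2 + nu *m Jac (h q.1) q.2).
  by apply/funext => q; rewrite (grad_lagrangian smooth).
have s1 := C1_at_strict_diff (grad_f_C1 smooth (theta, xb)).
have s2 := C1_at_strict_diff (Jac_g_C1 smooth (theta, xb)).
have s3 := C1_at_strict_diff (Jac_h_C1 smooth (theta, xb)).
have s2' := strict_diff_mulmx (strict_diff_cst lam (theta, xb)) s2.
have s3' := strict_diff_mulmx (strict_diff_cst nu (theta, xb)) s3.
apply: (strict_diff_ext (strict_diff_add (strict_diff_add s1 s2') s3')) => w.
by rewrite /dlagr !mul0mx !add0r.
Qed.

Section Solution.
Variables (dt : 'rV[R]_nt) (dy : 'rV[R]_(nx + nin)).
Hypothesis Dv : D (dt, dy) = 0.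
Let dx := lsubmx dy.
Let dz := rsubmx dy.
Let dlam := lsubmx (M (dt, dy)).
Let dnu := rsubmx (M (dt, dy)).

Lemma dresidual_eqs :
  dlagr (dt, dx) + rho *: dx + dlam *m Jac (g theta) xb + dnu *m Jac (h theta) xb = 0 /\
  dz *m diag_mx lam + zb *m diag_mx dlam + rho *: dz = 0.
Proof.
move: Dv; rewrite /dresidual /= reduced_mu0 -/lam -/nu -/dx -/dz -/dlam -/dnu.
rewrite /y0 row_mxKl row_mxKr -row_mx0 => /eq_row_mx[<- ->]; split=> //.
rewrite /dlagr; set a := 'd _ _ _; set b := lam *m _; set c := nu *m _.
set d := dlam *m _; set e := dnu *m _.
by apply/rowP => j; rewrite !mxE; ring.
Qed.

Lemma dlamE : rho *: dlam = Dg (dt, dx) + dz *m diag_mx zb.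
Proof.
rewrite /dlam /dmu /= /y0 row_mxKl row_mxKr -/dx -/dz linearZ /= row_mxKl.
by rewrite scalerA mulfV ?gt_eqF// scale1r.
Qed.

Lemma dnuE : rho *: dnu = Dh (dt, dx).
Proof.
rewrite /dnu /dmu /= /y0 row_mxKl -/dx linearZ /= row_mxKr.
by rewrite scalerA mulfV ?gt_eqF// scale1r.
Qed.

(** An active constraint has z = 0, which kills the term z dz. *)
Lemma dlam_active : rho *: subvec I dlam = subvec I (Dg (dt, dx)).
Proof.
rewrite -(blZ _ _ (bl_subvec I)) dlamE (blD _ _ (bl_subvec I)).
suff -> : subvec I (dz *m diag_mx zb) = 0 by rewrite addr0.
apply/rowP => k; rewrite mxE mul_mx_diag mxE [RHS]mxE.
by rewrite (active_slack0 (enum_valP k)) mulr0.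
Qed.

Lemma dlam_inactive :
  subvec Ic dlam = subvec Ic (Dg (dt, dx)) *m inactive_weight g theta xib rho.
Proof.
have [_ e2] := dresidual_eqs; have e1 := dlamE.
apply/rowP => k; rewrite mul_mx_diag [LHS]mxE [RHS]mxE [X in X * _]mxE [X in _ * X]mxE.
apply: (slack_elimination rho0 _ e1 e2).
by apply: inactive_mult0; exact: enum_valP.
Qed.

(** The increments of x, of the active multipliers and of the equality
    multipliers, in the order of the unknowns of A + B. *)
Definition kkt_increment : 'cV[R]_(nx + (#|I| + neq)) :=
  col_mx dx^T (col_mx (subvec I dlam)^T dnu^T).

(** The inactive multipliers are eliminated by [dlam_inactive]; their
    x-part becomes Hmat and their parameter part becomes lmat. *)
Theorem dresidual_system :
  (Amat f g h theta xib + Bmat (neq := neq) g theta xib rho) *m kkt_increment =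
  - ((bvec f g h theta xib + dvec (neq := neq) g theta xib rho) *m dt^T).
Proof.
have [e1 _] := dresidual_eqs.
have sg := C1_at_strict_diff (g_C1 smooth (theta, xb)).
have sh := C1_at_strict_diff (h_C1 smooth (theta, xb)).
have sgx := strict_diff_x sg; have sgt := strict_diff_t sg.
have shx := strict_diff_x sh; have sht := strict_diff_t sh.
have slx := strict_diff_x strict_diff_dlagr.
have slt := strict_diff_t strict_diff_dlagr.
have splitw (W : normedModType R) (L : 'rV[R]_nt * 'rV[R]_nx -> W) :
    bounded_linear L -> L (dt, dx) = L (0, dx) + L (dt, 0).
  by move=> bL; rewrite (bl_split _ _ bL) addrC.
rewrite system_blockE mul_block_col -/xb -/lam -/nu.
rewrite /bvec /dvec add_col_mx add_col_mx !addr0 !mul_col_mx !opp_col_mx.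
rewrite -/xb -/lam -/nu -/I.
rewrite !mulNmx !mul_scalar_mx scale_col_mx opp_col_mx add_col_mx.
congr (col_mx _ (col_mx _ _)).
- rewrite tr_col_mx mul_row_col !mulmxDl mul_scalar_mx.
  rewrite (Jac_strict_diff _ slx) (Jac_strict_diff _ slt).
  rewrite /Hmat /lmat -/xb -/Ic -!mulmxA (Jac_subvec Ic _ sgx) (Jac_subvec Ic _ sgt).
  set W := inactive_weight _ _ _ _.
  have -> : W *m (subvec Ic (Dg (0, dx)))^T =
     (subvec Ic dlam)^T - W *m (subvec Ic (Dg (dt, 0)))^T.
    rewrite dlam_inactive (splitw _ _ (sd_bl sg)) (blD _ _ (bl_subvec Ic)).
    by rewrite trmx_mul tr_diag_mx linearD mulmxDr addrK.
  rewrite mulmxBr.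
  have := congr1 trmx e1; rewrite (mulmx_split I dlam).
  rewrite -(Jac_subvecE I sgx) -(Jac_subvecE (~: I)%SET sgx).
  rewrite (splitw _ _ (sd_bl strict_diff_dlagr)).
  rewrite !linearD /= trmx0 linearZ /= !trmx_mul => E.
  exact: rearrange_first_block E.
- rewrite (Jac_subvec I _ sgx) (Jac_subvec I _ sgt) -linearZ dlam_active.
  rewrite (splitw _ _ (sd_bl sg)) (blD _ _ (bl_subvec I)) linearD /=.
  by rewrite opprD addrA subrr add0r.
- rewrite (Jac_strict_diff _ shx) (Jac_strict_diff _ sht) -linearZ dnuE.
  by rewrite (splitw _ _ (sd_bl sh)) linearD /= opprD addrA subrr add0r.
Qed.

End Solution.

(** With dt = 0 the system gives dx = 0.  What remains for each slack is
    (lam + z^2 / rho + rho) dz = 0, where lam >= 0. *)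
Lemma dresidual_injective dy :
  Amat f g h theta xib + Bmat (neq := neq) g theta xib rho \in unitmx ->
  D (0, dy) = 0 -> dy = 0.
Proof.
move=> unitAB Dv; have E := dresidual_system Dv.
have : kkt_increment 0 dy = 0.
  by rewrite -(mulKmx unitAB (kkt_increment 0 dy)) E trmx0 mulmx0 oppr0 mulmx0.
rewrite /kkt_increment -col_mx0 => /eq_col_mx[dx0 _].
have {}dx0 : lsubmx dy = 0 by apply: trmx_inj; rewrite dx0 trmx0.
have [_ e2] := dresidual_eqs Dv; have := dlamE 0 dy.
have bg := sd_bl (C1_at_strict_diff (g_C1 smooth (theta, xb))).
rewrite dx0 (bl0 bg) add0r => e1.
rewrite -[dy]hsubmxK dx0; suff -> : rsubmx dy = 0 by rewrite row_mx0.
move: e1 e2; move: (rsubmx dy) (lsubmx _) => dz dl e1 e2.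
have [_ _ _ lam0 _] := Xi_facts.
apply/rowP => i; rewrite mxE.
move/rowP/(_ i): e1; rewrite mul_mx_diag !mxE => e1.
move/rowP/(_ i): e2; rewrite !mul_mx_diag.
rewrite [LHS]mxE [RHS]mxE [X in X + _]mxE [X in X + _ + _]mxE [X in _ + X + _]mxE [X in _ + X]mxE.
move: (lam0 i) e1; move: (dl 0 i) (dz 0 i) (zb 0 i) (lam 0 i) => d s z l l0 e1 e2.
have : s * (rho * l + z ^+ 2 + rho ^+ 2) = 0.
  have -> : s * (rho * l + z ^+ 2 + rho ^+ 2) =
    rho * (s * l + z * d + rho * s) - z * (rho * d - s * z) by ring.
  by rewrite e2 e1 subrr !mulr0 subrr.
move/eqP; rewrite mulf_eq0 => /orP[/eqP //|].
by rewrite gt_eqF// ltr_wpDl ?exprn_gt0// addr_ge0 ?sqr_ge0// mulr_ge0// ltW.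
Qed.

End Link.

(** * The solution map *)

Section SolutionMap.
Context {R : realType} {nt nx nin neq : nat}.
Variables (f : 'rV[R]_nt -> 'rV[R]_nx -> R)
          (g : 'rV[R]_nt -> 'rV[R]_nx -> 'rV[R]_nin)
          (h : 'rV[R]_nt -> 'rV[R]_nx -> 'rV[R]_neq).
Hypothesis smooth : smooth_data f g h.
Variable theta : 'rV[R]_nt.
Variable xib : 'rV[R]_nx * 'rV[R]_nin * 'rV[R]_(nin + neq).
Hypothesis xib_Xi : Xi f g h theta xib.
Variable rho : R.
Hypothesis rho0 : 0 < rho.
Hypothesis unitAB :
  Amat f g h theta xib + Bmat (neq := neq) g theta xib rho \in unitmx.

Let y0 := row_mx xib.1.1 xib.1.2.

Lemma primal_dual_residual t (e : 'rV[R]_nx * 'rV[R]_nin * 'rV[R]_(nin + neq) * 'rV[R]_(nin + neq)) :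
  P3_primal_dual_solution f g h xib rho t e ->
  let y := row_mx e.1.1.1 e.1.1.2 in
  residual f g h xib rho (t, y) = 0 /\
  e = (lsubmx y, rsubmx y, reduced_mu g h xib rho t y, reduced_mu g h xib rho t y).
Proof.
move: e => [[[x z] mu] psi] [_ /(P3_kktE smooth xib rho0)[-> muE res0]] /=.
by rewrite row_mxKl row_mxKr -muE.
Qed.

Lemma residual_primal_dual t y :
  residual f g h xib rho (t, y) = 0 ->
  (\forall y' \near y, reduced_obj f g h xib rho t y <= reduced_obj f g h xib rho t y') ->
  P3_primal_dual_solution f g h xib rho t
    (lsubmx y, rsubmx y, reduced_mu g h xib rho t y, reduced_mu g h xib rho t y).
Proof.
move=> res0 miny; split; first exact/(P3_min_reduced smooth xib rho0).
by apply/(P3_kktE smooth xib rho0); rewrite hsubmxK.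
Qed.

Lemma base_local_min : P3_primal_dual_solution f g h xib rho theta (base_pair xib) ->
  \forall y \near y0, reduced_obj f g h xib rho theta y0 <= reduced_obj f g h xib rho theta y.
Proof.
move=> PD; apply/(P3_min_reduced smooth xib rho0).
rewrite (reduced_mu0 xib_Xi rho) /y0 row_mxKl row_mxKr.
by move: PD; rewrite /base_pair; case: (xib) => [[x z] mu] [].
Qed.

(** [local_min_branch] for [reduced_obj]; the derivative of the branch is a
    solution of the linearized residual equation. *)
Lemma smooth_solution_map :
  P3_primal_dual_solution f g h xib rho theta (base_pair xib) ->
  exists2 eta, P3_solution_map f g h xib rho theta eta &
    (\forall t \near theta, exists L, strict_diff eta t L) /\
    exists2 L, strict_diff eta theta L & forall v, exists dy,
      (L v).1.1.1 = lsubmx dy /\ dresidual f g h xib rho (theta, y0) (v, dy) = 0.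
Proof.
move=> PD.
have injD dy : dresidual f g h xib rho (theta, y0) (0, dy) = 0 -> dy = 0.
  exact: (dresidual_injective smooth xib_Xi rho0 unitAB).
have [r r0 [Y Y0 HY]] := local_min_branch
  (fun t y => (diff_reduced_obj smooth xib rho0 t y).1)
  (fun t y => (diff_reduced_obj smooth xib rho0 t y).2)
  (strict_diff_residual smooth xib rho) injD (base_local_min PD).
pose mu t := reduced_mu g h xib rho t (Y t).
pose eta t := (lsubmx (Y t), rsubmx (Y t), mu t, mu t).
have eta0 : eta theta = base_pair xib.
  rewrite /eta /mu Y0 (reduced_mu0 xib_Xi rho) /y0 row_mxKl row_mxKr /base_pair.
  by case: (xib) => [[x z] m].
have sdeta t L : strict_diff Y t L -> strict_diff eta t
    (fun v => (lsubmx (L v), rsubmx (L v), dmu g h rho (t, Y t) (v, L v),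
               dmu g h rho (t, Y t) (v, L v))).
  move=> sY.
  have sl := strict_diff_comp sY (strict_diff_lin _ (bl_lsubmx nx nin)).
  have sr := strict_diff_comp sY (strict_diff_lin _ (bl_rsubmx nx nin)).
  have sm := strict_diff_comp (strict_diff_pair (strict_diff_lin t (bl_id _)) sY)
     (strict_diff_mu smooth xib rho (t, Y t)).
  exact: (strict_diff_pair (strict_diff_pair (strict_diff_pair sl sr) sm) sm).
exists eta; last split.
- split; first exact: eta0.
  pose r4 (e : 'rV[R]_nx * 'rV[R]_nin * 'rV[R]_(nin + neq) * 'rV[R]_(nin + neq)) :=
    row_mx e.1.1.1 e.1.1.2.
  exists [set e | `|r4 e - y0| < r].
    have c4 : continuous r4.
      apply: bl_continuous; apply: (bl_comp (bl_row_mx nx nin)).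
      exact: (bl_comp (bl_fst _ _) (bl_fst _ _)).
    have nr : \forall y \near r4 (base_pair xib), `|y - y0| < r.
      by apply/nbhs_norm_ltP; exists r.
    exact: (c4 _ _ nr).
  apply: filterS HY => t [[Yr KY] uY mY _]; split.
  + by rewrite /= /r4 /eta /= hsubmxK.
  + exact: residual_primal_dual.
  + move=> e /= er /primal_dual_residual[res0 ->].
    by rewrite /eta /mu -(uY _ er res0).
- by apply: filterS HY => t [_ _ _ [L sY _]]; eexists; exact: (sdeta t L sY).
- have [_ _ _ [L sY DL]] := nbhs_singleton HY.
  eexists; first exact: (sdeta theta L sY).
  by move=> v; exists (L v); split=> //; rewrite -Y0; exact: DL.
Qed.

Lemma sensitivity_derivative V v dy :
  sensitivity_system f g h theta xib rho V ->
  dresidual f g h xib rho (theta, y0) (v, dy) = 0 ->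
  (lsubmx dy)^T = - usubmx V *m v^T.
Proof.
move=> VE /(dresidual_system smooth xib_Xi rho0) E.
have : kkt_increment g h theta xib rho v dy = - (V *m v^T).
  rewrite -(mulKmx unitAB (kkt_increment _ _ _ _ _ _ _)) E -VE mulmxN -mulmxA.
  by rewrite (mulKmx unitAB).
move/(congr1 usubmx); rewrite /kkt_increment col_mxKu => ->.
by rewrite linearN /= mulNmx mul_usub_mx.
Qed.

(** The given map is only known to be single-valued in U.  The smooth branch
    is continuous at theta, so it lies in U near theta and coincides there with
    the given map, which inherits its regularity and derivative. *)
Lemma solution_map_sensitivity V eta :
  sensitivity_system f g h theta xib rho V ->
  P3_solution_map f g h xib rho theta eta ->
  C1_at eta theta /\ Jac (fun t => (eta t).1.1.1) theta = - usubmx V.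
Proof.
move=> VE [eta0 [U nU HU]].
have PD : P3_primal_dual_solution f g h xib rho theta (base_pair xib).
  by rewrite -eta0; case: (nbhs_singleton HU).
have [eta' [eta0' [U' _ HU']] [sd [L sL DL]]] := smooth_solution_map PD.
have cU : \forall t \near theta, U (eta' t).
  by apply: (strict_diff_continuous sL); rewrite eta0'.
have eq_eta : \forall t \near theta, eta' t = eta t.
  near=> t.
  have [_ _ uniq] : [/\ U (eta t), P3_primal_dual_solution f g h xib rho t (eta t) &
    forall e, U e -> P3_primal_dual_solution f g h xib rho t e -> e = eta t].
    by near: t.
  apply: uniq; first by near: t.
  have [_ //] : [/\ U' (eta' t), P3_primal_dual_solution f g h xib rho t (eta' t) &
    forall e, U' e -> P3_primal_dual_solution f g h xib rho t e -> e = eta' t].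
    by near: t.
split.
  apply: strict_diff_C1_at.
  have eq_eta2 : \forall t \near theta, \forall s \near t, eta' s = eta s.
    exact: nbhs_interior.
  apply: filterS (filterI sd eq_eta2) => t [[M sM] e]; exists M.
  exact: strict_diff_near_eq e sM.
have bx : bounded_linear (fun e : 'rV[R]_nx * 'rV[R]_nin * 'rV[R]_(nin + neq)
    * 'rV[R]_(nin + neq) => e.1.1.1).
  exact: (bl_comp (bl_fst _ _) (bl_comp (bl_fst _ _) (bl_fst _ _))).
have sx := strict_diff_comp (strict_diff_near_eq eq_eta sL) (strict_diff_lin _ bx).
apply/matrixP => i j.
have [dy [dyE Ddy]] := DL (delta_mx 0 j).
have := Jac_strict_diff (delta_mx 0 j) sx.
rewrite dyE (sensitivity_derivative VE Ddy) trmx_delta -!colE.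
by move=> /colP/(_ i); rewrite [LHS]mxE [RHS]mxE.
Unshelve. all: by end_near. Qed.

End SolutionMap.

Theorem lemma3 (R : realType) (nt nx nin neq : nat)
    (f : 'rV[R]_nt -> 'rV[R]_nx -> R)
    (g : 'rV[R]_nt -> 'rV[R]_nx -> 'rV[R]_nin)
    (h : 'rV[R]_nt -> 'rV[R]_nx -> 'rV[R]_neq)
    (smooth : smooth_data f g h)
    (theta : 'rV[R]_nt)
    (xib : 'rV[R]_nx * 'rV[R]_nin * 'rV[R]_(nin + neq))
    (xib_Xi : Xi f g h theta xib) :
  \forall rho \near (0 : R)^'+,
    exists V, unique (sensitivity_system f g h theta xib rho) V /\
      (P3_primal_dual_solution f g h xib rho theta (base_pair xib) ->
        exists eta, P3_solution_map f g h xib rho theta eta) /\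
      (forall eta, P3_solution_map f g h xib rho theta eta ->
        C1_at eta theta /\
        Jac (fun t => (eta t).1.1.1) theta = - usubmx V).
Proof.
near=> rho.
have rho0 : 0 < rho by near: rho; exact: nbhs_right_gt.
have unitAB : Amat f g h theta xib + Bmat (neq := neq) g theta xib rho \in unitmx.
  by near: rho; exact: system_unitmx.
set AB := _ + _ in unitAB.
pose V := invmx AB *m (bvec f g h theta xib + dvec (neq := neq) g theta xib rho).
have VE : sensitivity_system f g h theta xib rho V.
  by rewrite /sensitivity_system -/AB /V mulKVmx.
exists V; split; last split.
- split=> // V' V'E; rewrite /V -V'E -/AB mulKmx//.
- move=> PD; have [eta E _] := smooth_solution_map smooth xib_Xi rho0 unitAB PD.
  by exists eta.
- by move=> eta; exact: (solution_map_sensitivity smooth xib_Xi rho0 unitAB VE).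
Unshelve. all: by end_near. Qed.
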